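(* (i) If $f \in \mathrm{U}(\mathbb{R})$ is nonzero and has bounded spectrum, then there exist a real number $C_f > 0$ and an integer $n \geq 1$ such that $$J_f(u) \leq C_f\, u^{1/n} \quad \text{for all } u > 0.$$ (ii) There exists a sequence of real numbers $(C_n)_{n \geq 1}$ such that for every integer $n \geq 1$ and every trigonometric polynomial $f \in \mathrm{T}(\mathbb{R})$ having $n+1$ frequencies, $$J_f(u) \leq C_n\, H_f^{-1/n}\, u^{1/n} \quad \text{for all } u > 0.$$
   Context: For $\omega \in \mathbb{R}$ let $\chi_\omega(x) = e^{i\omega x}$, $x \in \mathbb{R}$. A trigonometric polynomial is a finite sum $f = \sum_\omega a_\omega \chi_\omega$ with distinct real frequencies $\omega$ and complex coefficients $a_\omega$; the set of these is $\mathrm{T}(\mathbb{R})$. Saying that $f$ has $n+1$ frequencies means that exactly $n+1$ of the coefficients are nonzero. The height of $f$ is $H_f = \max_\omega |a_\omega|$. $\mathrm{U}(\mathbb{R})$ is the set of uniformly (Bohr) almost periodic functions, that is, the closure of $\mathrm{T}(\mathbb{R})$ in the space of bounded continuous functions $\mathbb{R} \to \mathbb{C}$ with the supremum norm. For $f \in \mathrm{U}(\mathbb{R})$ the mean $m(f) = \lim_{L\to\infty} (2L)^{-1}\int_{-L}^{L} f(t)\,dt$ exists. The Fourier transform is $\widehat f(\omega) = m(f\,\overline{\chi_\omega})$ for $\omega\in\mathbb{R}$, and the spectrum is $\Omega(f) = \{\omega \in \mathbb{R} : \widehat f(\omega) \neq 0\}$. A nonzero $f$ has bounded spectrum if $b(f)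 = \sup\Omega(f) - \inf\Omega(f)$ is finite. For measurable $S \subseteq \mathbb{R}$, $m(S) = \lim_{L\to\infty} (2L)^{-1}\,\mathrm{measure}([-L,L]\cap S)$ (Lebesgue measure), when this limit exists; it is taken to exist for the sets considered here. Define $J_f : (0,\infty)\to[0,1]$ by $J_f(u) = m(\{x\in\mathbb{R} : |f(x)| < u\})$. *)

(* Defs.v *)
(* MathComp-Analysis *)
From HB Require Import structures.
From mathcomp Require Import all_boot all_order all_algebra finmap complex.
From mathcomp Require Import all_classical all_reals all_analysis.

Set Implicit Arguments.
Unset Strict Implicit.
Unset Printing Implicit Defensive.

Import Order.TTheory GRing.Theory Num.Theory.
Import numFieldNormedType.Exports.

Local Open Scope classical_set_scope.
Local Open Scope ring_scope.
Local Open Scope complex_scope.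

(* R[i] comes without a topology; give it the one induced by its norm. *)
HB.instance Definition _ (R : realType) := PseudoMetric.copy R[i] R[i]^o.
HB.instance Definition _ (R : realType) := Pointed.copy R[i] R[i]^o.

(* The modulus as an element of R: the norm `|z| of R[i] is (cabs z)%:C. *)
Definition cabs (R : realType) (z : R[i]) : R := ComplexField.Normc.normc z.

Definition chi (R : realType) (w : R) : R -> R[i] :=
  fun x => cos (w * x) +i* sin (w * x).

(* A trigonometric polynomial is represented by its finitely supported
   coefficient function w |-> a_w; its frequencies are finsupp a. *)
Definition trigpoly (R : realType) := {fsfun R -> R[i] with 0}.

Definition trigpoly_fun (R : realType) (a : trigpoly R) : R -> R[i] :=
  fun x => \sum_(w <- finsupp a) a w * chi w x.

Definition height (R : realType) (a : trigpoly R) : R :=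
  \big[Num.max/0]_(w <- finsupp a) cabs (a w).

Definition uniformly_almost_periodic (R : realType) (f : R -> R[i]) : Prop :=
  [/\ continuous f,
      exists M : R, forall x, cabs (f x) <= M &
      forall e : R, 0 < e ->
        exists a : trigpoly R, forall x, cabs (f x - trigpoly_fun a x) <= e].

Definition cintegral (R : realType) (D : set R) (f : R -> R[i]) : R[i] :=
  Rintegral lebesgue_measure D (fun x => complex.Re (f x)) +i*
  Rintegral lebesgue_measure D (fun x => complex.Im (f x)).

Definition mean (R : realType) (f : R -> R[i]) : R[i] :=
  lim (((2 * L)^-1)%:C * cintegral `[- L, L] f @[L --> +oo]).

Definition fourier (R : realType) (f : R -> R[i]) (w : R) : R[i] :=
  mean (fun x => f x * (chi w x)^*).

Definition spectrum (R : realType) (f : R -> R[i]) : set R :=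
  [set w | fourier f w != 0].

Definition bandwidth (R : realType) (f : R -> R[i]) : \bar R :=
  (ereal_sup (EFin @` spectrum f) - ereal_inf (EFin @` spectrum f))%E.

(* As everywhere in the library, lim is a default value (here 0) when the
   limit does not exist. *)
Definition mean_measure (R : realType) (S : set R) : R :=
  lim ((2 * L)^-1 * fine (lebesgue_measure (`[- L, L] `&` S)) @[L --> +oo]).

Definition J (R : realType) (f : R -> R[i]) (u : R) : R :=
  mean_measure [set x | cabs (f x) < u].

(* Main.v *)
Require Import Defs.
From mathcomp Require Import ring lra zify.
From mathcomp Require Import all_boot all_order all_algebra finmap complex.
From mathcomp Require Import all_classical all_reals all_analysis.

Set Implicit Arguments.
Unset Strict Implicit.
Unset Printing Implicit Defensive.

Import Order.TTheory GRing.Theory Num.Theory.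
Import numFieldNormedType.Exports.

Local Open Scope classical_set_scope.
Local Open Scope ring_scope.
Local Open Scope complex_scope.

(** Both parts rest on one mechanism.  If the real functions g' - c and g' + c
    change sign a bounded number of times on an interval, then the set where
    |g| < u and |g'| > c has measure O(u / c) there.

    (ii) Modulate f so that the frequency farthest from the one carrying the
    height H, at distance b say, becomes 0.  Then f' has one frequency less and
    height at least b H, and by induction the set {|f'| < b H t^(n-1)} has density
    O(t).  On each interval of length of order 1/b, real trigonometric sums with n
    frequencies of size O(b) have O_n(1) sign changes, so the rest of
    {|f| < H t^n} has density O(t) as well.

    (i) Bochner-Fejér summation over a Følner set of frequencies approximates f
    uniformly by trigonometric sums p with frequencies in the bounded spectrum, and
    Bernstein's inequality bounds all derivatives: |p^(k)| <= M D^k.  Since a Fourier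
    coefficient of f does not vanish, every window of a fixed length contains a point
    where |p| >= d; by Taylor's formula some derivative of order < n of Re p or Im p
    is then bounded below at each point, hence on an interval of fixed length, and
    the mechanism above, iterated, gives |{|p| < e t^n}| = O(t) on it.  All constants
    are independent of p. *)

(** * Lebesgue outer measure *)

(* [lebesgue_measure] is defined as an outer measure on all sets, so that
   monotonicity and subadditivity need no measurability. *)
Lemma le_lebesgue_outer (R : realType) (A B : set R) :
  A `<=` B -> (lebesgue_measure A <= lebesgue_measure B)%E.
Proof. exact: (le_outer_measure (mu_ext (wlength idfun))). Qed.

Lemma lebesgue_outerU (R : realType) (A B : set R) :
  (lebesgue_measure (A `|` B) <= lebesgue_measure A + lebesgue_measure B)%E.
Proof. exact: (outer_measureU2 (mu_ext (wlength idfun))). Qed.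

Definition outer_le (R : realType) (A : set R) (m : R) :=
  (lebesgue_measure A <= m%:E)%E.

Section outer_le.
Context {R : realType}.
Implicit Types (A B : set R) (a b m : R).

Lemma outer_le_sub A B m : outer_le B m -> A `<=` B -> outer_le A m.
Proof. by move=> Bm AB; apply: le_trans Bm; exact: le_lebesgue_outer. Qed.

Lemma outer_leW A m (n : R) : m <= n -> outer_le A m -> outer_le A n.
Proof. by move=> mn /le_trans; apply; rewrite lee_fin. Qed.

Lemma outer_leU A B m (n : R) :
  outer_le A m -> outer_le B n -> outer_le (A `|` B) (m + n).
Proof.
by move=> Am Bn; rewrite /outer_le (le_trans (lebesgue_outerU _ _))// EFinD leeD.
Qed.

Lemma outer_le0 : outer_le (set0 : set R) 0.
Proof. by rewrite /outer_le measure0. Qed.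

Lemma outer_le_itv a b : a <= b -> outer_le [set x | a <= x <= b] (b - a).
Proof.
move=> ab; rewrite /outer_le.
have -> : [set x | a <= x <= b] = [set` `[a, b]].
  by apply/seteqP; split => x /=; rewrite in_itv.
rewrite lebesgue_measure_itv /= lte_fin; case: ifP => _; first by rewrite -EFinB.
by rewrite lee_fin subr_ge0.
Qed.

Lemma outer_le_ge0 A m : outer_le A m -> 0 <= m.
Proof. by move=> h; rewrite -lee_fin (le_trans _ h). Qed.

(** About 2L/h windows of length h cover [-L, L]; as h <= L, rounding up still leaves at most 3L/h
    of them. *)
Lemma outer_le_long A m h L : 0 < h <= L ->
  (forall a, outer_le (A `&` [set x | a <= x <= a + h]) m) ->
  outer_le (A `&` [set x | - L <= x <= L]) (3 * L / h * m).
Proof.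
move=> /andP[h0 hL] Ah.
have m0 : 0 <= m := outer_le_ge0 (Ah 0).
(* Half-open on the right, so that zero windows give the empty set; the strict bound 2L/h < n below
   recovers the endpoint L. *)
have iter n : outer_le (A `&` [set x | - L <= x < - L + h *+ n]) (m *+ n).
  elim: n => [|n IH].
    rewrite !mulr0n addr0; apply: (outer_le_sub outer_le0) => x [_ /=].
    by move=> /andP[/le_lt_trans] /[apply]; rewrite ltxx.
  rewrite [m *+ _]mulrSr; apply: (outer_le_sub (outer_leU IH (Ah (- L + h *+ n)))).
  move=> x [Ax /= /andP[Lx xL]].
  have [?|?] := ltP x (- L + h *+ n); [left|right]; split=> //=.
    by rewrite Lx.
  by rewrite -addrA -mulrSr ltW.
pose n := (Num.truncn (2 * L / h)).+1.
have /andP[n1 n2] : (n.-1%:R <= 2 * L / h < n%:R).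
  by apply: truncn_itv; rewrite divr_ge0 ?mulr_ge0//; lra.
have Lh : 1 <= L / h by rewrite ler_pdivlMr// mul1r.
apply: (outer_leW (m := m *+ n)).
  rewrite -[m *+ _]mulr_natl ler_wpM2r//.
  have -> : n%:R = n.-1%:R + 1 :> R by rewrite -natr1.
  rewrite -mulrA; rewrite -mulrA in n1; lra.
apply: (outer_le_sub (iter n)) => x [Ax /= /andP[Lx xL]]; split=> //=.
rewrite Lx/= (le_lt_trans xL)// -[h *+ n]mulr_natl.
move: n2; rewrite ltr_pdivrMr// => n2; lra.
Qed.

End outer_le.

(** * Sign partitions and fast sublevel sets *)

Section sign_partition.
Context {R : realType}.
Implicit Types (G H : R -> R) (a b c x y : R) (N : nat).

Lemma derive_ndecr G dG a b : (forall x, a <= x <= b -> is_derive x 1 G (dG x)) ->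
  (forall x, a <= x <= b -> 0 <= dG x) ->
  forall x y, a <= x -> x <= y -> y <= b -> G x <= G y.
Proof.
move=> dGP dG0 x y ax xy yb.
have [||z zxy] := @MVT_segment R G dG x y xy.
- by move=> z; rewrite in_itv/= => /andP[/ltW xz /ltW zy]; apply: dGP; lra.
- apply: continuous_in_subspaceT => z; rewrite inE/= in_itv/= => /andP[xz zy].
  by apply/differentiable_continuous/derivable1_diffP/(@ex_derive _ _ _ _ _ _ _ (dGP z _)); lra.
- move: zxy; rewrite in_itv/= => /andP[xz zy] /eqP; rewrite subr_eq => /eqP ->.
  by rewrite lerDr mulr_ge0 ?subr_ge0// dG0//; lra.
Qed.

Definition const_sign G a b :=
  (forall x, a <= x <= b -> 0 <= G x) \/ (forall x, a <= x <= b -> G x <= 0).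

(** Signs are weak and a piece may be a single point, so the zero function needs one piece and a
    count can be padded: the index acts as an upper bound. *)
Inductive sign_part G : nat -> R -> R -> Prop :=
| sign_part1 a b : a <= b -> const_sign G a b -> sign_part G 1 a b
| sign_part_cat m n a c b :
    sign_part G m a c -> sign_part G n c b -> sign_part G (m + n) a b.

Lemma sign_part_le G N a b : sign_part G N a b -> a <= b.
Proof. by elim=> // m n x z y _ + _; exact: le_trans. Qed.

Lemma sign_part_eq G H N a b :
  (forall x, a <= x <= b ->
    (0 <= G x -> 0 <= H x) /\ (G x <= 0 -> H x <= 0)) ->
  sign_part G N a b -> sign_part H N a b.
Proof.
move=> + GN; elim: GN => [x y xy cG GH|m n x z y xz IH1 zy IH2 GH].
  apply: sign_part1 => //; case: cG => cG; [left|right] => t txy.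
    by apply: (GH _ txy).1; exact: cG.
  by apply: (GH _ txy).2; exact: cG.
have := sign_part_le xz; have := sign_part_le zy => ? ?.
by apply: (sign_part_cat (c := z)); [apply: IH1|apply: IH2] => t ?; apply: GH; lra.
Qed.

Lemma sign_partN G N a b : sign_part G N a b -> sign_part (fun x => - G x) N a b.
Proof.
elim=> [x y xy cG|m n x z y _ + _]; last exact: sign_part_cat.
apply: sign_part1 => //; case: cG => cG; [right|left] => t /cG.
  by rewrite oppr_le0.
by rewrite oppr_ge0.
Qed.

(** On each piece of the derivative G is monotone, so it changes sign at most once there and the
    piece splits in two. *)
Lemma sign_part_derive G dG N a b :
  (forall x, a <= x <= b -> is_derive x 1 G (dG x)) ->
  sign_part dG N a b -> sign_part G N.*2 a b.
Proof.
move=> + dGN; elim: dGN G => [x y xy cG G dGP|m n x z y xz IH1 zy IH2 G GH]; last first.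
  have := sign_part_le xz; have := sign_part_le zy => ? ?.
  rewrite doubleD.
  by apply: (sign_part_cat (c := z)); [apply: IH1|apply: IH2] => t ?; apply: GH; lra.
wlog {cG} cG : G dG dGP / (forall t, x <= t <= y -> 0 <= dG t).
  move=> wl; case: cG => cG; first exact: (wl G dG).
  have /sign_partN : sign_part (fun t => - G t) 1.*2 x y.
    apply: (wl _ (fun t => - dG t)) => t txy; last by rewrite oppr_ge0 cG.
    have ? := dGP t txy; exact: is_deriveN.
  by apply: sign_part_eq => t _; rewrite opprK.
have mG := derive_ndecr dGP cG.
(* Without a strict sign change the one-point piece [x, x] pads the count to two; otherwise the cut
   is a zero of G. *)
have [Gx|Gx] := leP 0 (G x).
  apply: (@sign_part_cat _ 1 1 _ x); apply: sign_part1 => //; left => t /andP[xt ty];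
  by rewrite (le_trans Gx)// mG//; lra.
have [Gy|Gy] := leP (G y) 0.
  apply: (@sign_part_cat _ 1 1 _ x); apply: sign_part1 => //; right => t /andP[xt ty];
  by rewrite (le_trans _ Gy)// mG//; lra.
have [||z] := @IVT R G x y 0 xy.
- apply: continuous_in_subspaceT => z; rewrite inE/= in_itv/= => /dGP ?.
  by apply/differentiable_continuous/derivable1_diffP/ex_derive.
- rewrite (min_idPl _) ?(max_idPr _) ?(ltW Gx) ?(ltW Gy)//; lra.
rewrite in_itv/= => /andP[xz zy] Gz.
apply: (@sign_part_cat _ 1 1 _ z); apply: sign_part1 => //; [right|left] => t /andP[? ?];
by rewrite -Gz mG//; lra.
Qed.

(** With slope at least c, two points where |G| < u are within 2u/c of each other, so the set fits
    in an interval of that radius around any of its points. *)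
Lemma outer_le_monotone G dG a b u c : 0 < u -> 0 < c ->
  (forall x, a <= x <= b -> is_derive x 1 G (dG x)) ->
  (forall x, a <= x <= b -> c <= dG x) ->
  outer_le [set x | a <= x <= b /\ `|G x| < u] (4 * u / c).
Proof.
move=> u0 c0 dGP dGc.
have [->|/set0P[x0 [x0ab Gx0]]] := eqVneq [set x | a <= x <= b /\ `|G x| < u] set0.
  by apply: outer_leW outer_le0; rewrite divr_ge0 ?mulr_ge0// ltW.
have mG x y : a <= x -> x <= y -> y <= b -> c * (y - x) <= G y - G x.
  move=> ax xy yb.
  have dGcP z : a <= z <= b -> is_derive z 1 (fun t => G t - c * t) (dG z - c).
    move=> zab; have ? := dGP z zab.
    by apply: is_derive_eq; rewrite /GRing.scale/=; ring.
  have := derive_ndecr dGcP _ ax xy yb; move=> /(_ _)/wrap[|]; last by lra.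
  by move=> z /dGc; rewrite subr_ge0.
have -> : 4 * u / c = (x0 + 2 * u / c) - (x0 - 2 * u / c) by lra.
have uc : 0 < u / c by rewrite divr_gt0.
apply: (outer_le_sub (outer_le_itv _)); first lra.
move=> x [/andP[ax xb] Gx] /=.
move: x0ab => /andP[ax0 x0b].
have := mulfVK (lt0r_neq0 c0) (2 * u) => e.
move: Gx Gx0; rewrite !ltr_norml => /andP[G1 G2] /andP[G3 G4].
have [xx0|x0x] := leP x x0.
  have := mG _ _ ax xx0 x0b => h.
  have : c * (x0 - x) <= c * (2 * u / c) by rewrite [leRHS]mulrC mulfVK ?gt_eqF//; lra.
  by rewrite ler_pM2l//; lra.
have := mG _ _ ax0 (ltW x0x) xb => h.
have : c * (x - x0) <= c * (2 * u / c) by rewrite [leRHS]mulrC mulfVK ?gt_eqF//; lra.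
by rewrite ler_pM2l//; lra.
Qed.

(** Where [dG] >= c on a piece the monotone estimate applies; where [dG] <= c the set is empty. *)
Lemma outer_le_fast_gt G dG N a b u c : 0 < u -> 0 < c ->
  (forall x, a <= x <= b -> is_derive x 1 G (dG x)) ->
  sign_part (fun x => dG x - c) N a b ->
  outer_le [set x | a <= x <= b /\ `|G x| < u /\ c < dG x] (N%:R * (4 * u / c)).
Proof.
move=> u0 c0 + P; elim: P => [x y xy cG dGP|m n x z y xz IH1 zy IH2 dGP].
  rewrite mul1r; case: cG => cG.
    apply: (outer_le_sub (outer_le_monotone u0 c0 dGP _)).
      by move=> t /cG; rewrite subr_ge0.
    by move=> t [? []].
  apply: outer_leW; last first.
    apply: (outer_le_sub outer_le0) => t [/cG + [_]]; lra.
  by rewrite divr_ge0 ?mulr_ge0// ltW.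
have := sign_part_le xz; have := sign_part_le zy => ? ?.
rewrite natrD mulrDl.
apply: (outer_le_sub (outer_leU (IH1 _) (IH2 _))).
- by move=> t ?; apply: dGP; lra.
- by move=> t ?; apply: dGP; lra.
- move=> t [/andP[xt ty] h]; have [?|?] := leP t z; [left|right]; split=> //; lra.
Qed.

(** The region [dG] < -c is the previous case for -G, whose sign pieces are those of [dG + c]
    negated. *)
Lemma outer_le_fast G dG N a b u c : 0 < u -> 0 < c ->
  (forall x, a <= x <= b -> is_derive x 1 G (dG x)) ->
  sign_part (fun x => dG x - c) N a b ->
  sign_part (fun x => dG x + c) N a b ->
  outer_le [set x | a <= x <= b /\ `|G x| < u /\ c < `|dG x|] (N%:R * (8 * u / c)).
Proof.
move=> u0 c0 dGP P1 P2.
have -> : N%:R * (8 * u / c) = N%:R * (4 * u / c) + N%:R * (4 * u / c) by lra.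
apply: (outer_le_sub (outer_leU (outer_le_fast_gt u0 c0 dGP P1)
  (@outer_le_fast_gt (fun x => - G x) (fun x => - dG x) N a b u c u0 c0 _ _))).
- by move=> x xab; have ? := dGP x xab; exact: is_deriveN.
- by have := sign_partN P2; apply: sign_part_eq => t _; rewrite opprD.
- move=> x [xab [Gu]]; rewrite ltr_normr => /orP[?|?]; [left|right] => //.
  by rewrite /= normrN.
Qed.

End sign_partition.

(** * Sublevel sets from a large higher derivative *)

Section derivative_chain.
Context {R : realType}.
Implicit Types (g : nat -> R -> R) (a b c t x : R).

Definition derivative_chain g := forall k x, is_derive x 1 (g k) (g k.+1 x).

Lemma sign_part_chain g m a b : derivative_chain g -> a <= b ->
  (forall x, a <= x <= b -> 0 <= g m x) -> sign_part (g 0%N) (2 ^ m) a b.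
Proof.
elim: m g => [|m IH] g gP ab gm.
  by rewrite expn0; apply: sign_part1 => //; left.
rewrite expnS mul2n; apply: (@sign_part_derive _ _ (g 1%N)) => [x _|]; first exact: gP.
by apply: (IH (fun k => g k.+1)).
Qed.

(** Induction on the order: passing from n to n + 1, the set where |g'| < c t^n is small by
    induction, and off it g' is fast. Both contributions are 16 2^n t, whence the doubling. *)
Lemma sublevel_derivative n g a b c t : derivative_chain g -> a <= b ->
  0 < c -> 0 < t -> (forall x, a <= x <= b -> c <= g n x) ->
  outer_le [set x | a <= x <= b /\ `|g 0%N x| < c * t ^+ n] (16 * 2 ^+ n * t).
Proof.
move=> + ab c0 t0; elim: n g => [|n IH] g gP gn.
  apply: (outer_leW (m := 0)); first by rewrite !mulr_ge0 ?exprn_ge0// ltW.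
  apply: (outer_le_sub outer_le0) => x /= [/gn ? ].
  by rewrite expr0 mulr1 => /(le_lt_trans (ler_norm _)); lra.
(* Half the splitting level: the weak inequality off the first set becomes the strict one that
   [outer_le_fast] asks for. *)
pose c' := c * t ^+ n / 2.
have ct0 : 0 < c * t ^+ n by rewrite mulr_gt0 ?exprn_gt0.
have c'0 : 0 < c' by rewrite divr_gt0.
have P e : `|e| <= c' -> sign_part (fun x => g 1%N x + e) (2 ^ n) a b.
  rewrite ler_norml => /andP[e1 e2].
  apply: (@sign_part_chain (fun k => if k is 0%N then (fun x => g 1%N x + e) else g k.+1)) => //.
    move=> [|k] x /=; last exact: gP.
    have ? := gP 1%N x.
    by apply: is_derive_eq; rewrite addr0.
  (* For n > 0 the shift e disappears on differentiating; for n = 0 it stays, but |e| <= c/2 keeps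
     g' + e positive. *)
  case: n IH gn @c' ct0 c'0 e1 e2 => [|n] _ gn /= _ _ e1 e2 x xab; last first.
    by rewrite (le_trans (ltW c0))// gn.
  by have := gn x xab; move: e1 e2; rewrite expr0 mulr1; lra.
have pc : `|c'| <= c' by rewrite ger0_norm// ltW.
have nc : `|- c'| <= c' by rewrite normrN.
have u0 : 0 < c * t ^+ n.+1 by rewrite mulr_gt0 ?exprn_gt0.
have F := outer_le_fast u0 c'0 (fun x _ => gP 0%N x) (P _ nc) (P _ pc).
have := IH (fun k => g k.+1) (fun k => gP k.+1) gn => {}IH.
apply: (outer_le_sub (outer_leW _ (outer_leU IH F))).
  rewrite /c' natrX !exprS.
  have -> : 8 * (c * (t * t ^+ n)) / (c * t ^+ n / 2) = 16 * t.
    by field; rewrite !gt_eqF// exprn_gt0.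
  by lra.
move=> x [xab gx]; have [?|?] := ltP `|g 1%N x| (c * t ^+ n); [left|right] => //.
by split=> //; split=> //; rewrite /c'; lra.
Qed.

End derivative_chain.

(** * Real trigonometric sums *)

Section trigsum.
Context {R : realType}.
Implicit Types (s : seq R) (A B : R -> R) (a b c t x w : R).

Definition trigsum s A B x := \sum_(w <- s) (A w * cos (w * x) + B w * sin (w * x)).

Lemma trigsum_nil A B x : trigsum [::] A B x = 0.
Proof. by rewrite /trigsum big_nil. Qed.

Lemma trigsum_cons w s A B x : trigsum (w :: s) A B x =
  A w * cos (w * x) + B w * sin (w * x) + trigsum s A B x.
Proof. by rewrite /trigsum big_cons. Qed.

Lemma is_derive_trigsum s A B x : is_derive x 1 (trigsum s A B)
  (trigsum s (fun w => w * B w) (fun w => - (w * A w)) x).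
Proof.
elim: s => [|w s IH].
  rewrite trigsum_nil (_ : trigsum _ _ _ = cst 0); first exact: is_derive_cst.
  by apply/funext => y; rewrite trigsum_nil.
rewrite trigsum_cons (_ : trigsum (w :: s) A B = fun y =>
  A w * cos (w * y) + B w * sin (w * y) + trigsum s A B y); last first.
  by apply/funext => y; rewrite trigsum_cons.
apply: is_derive_eq; rewrite /GRing.scale/=; ring.
Qed.

Fixpoint trigsum_coef A B k : (R -> R) * (R -> R) :=
  if k is k'.+1 then
    ((fun w => w * (trigsum_coef A B k').2 w),
     (fun w => - (w * (trigsum_coef A B k').1 w)))
  else (A, B).

Definition trigsum_chain s A B k :=
  trigsum s (trigsum_coef A B k).1 (trigsum_coef A B k).2.

Lemma trigsum_chainP s A B : derivative_chain (trigsum_chain s A B).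
Proof. by move=> k x; exact: is_derive_trigsum. Qed.

(* Polya's factorisation: with [phi x = cos (w (x - m))], which is positive on
   [[a, b]], one has [phi (g'' + w^2 g) = (phi^2 (g / phi)')'], and [g'' + w^2 g]
   no longer contains the frequency [w]. *)
Lemma trigsum_sign_part s A B a b : a <= b ->
  (forall w, w \in s -> `|w| * (b - a) <= 1) ->
  sign_part (trigsum s A B) (4 ^ size s) a b.
Proof.
move=> ab; elim: s A B => [|w s IH] A B sab.
  by apply: sign_part1 => //; left => x _; rewrite trigsum_nil.
pose m := (a + b) / 2.
pose phi x : R := cos (w * (x - m)).
pose psi x : R := w * sin (w * (x - m)).
have phi0 x : a <= x <= b -> 0 < phi x.
  move=> /andP[ax xb]; apply: cos_gt0_pihalf.
  rewrite -ltr_norml (le_lt_trans (y := 2^-1))//; last first.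
    by apply: lt_le_trans (@pihalf_ge1 R); lra.
  rewrite normrM; have := sab w (mem_head _ _).
  have : `|x - m| <= (b - a) / 2 by rewrite ler_norml /m; lra.
  move=> /(ler_wpM2l (normr_ge0 w)); lra.
pose g := trigsum (w :: s) A B.
pose dg := trigsum (w :: s) (fun w => w * B w) (fun w => - (w * A w)).
have gP x : is_derive x 1 g (dg x) by exact: is_derive_trigsum.
pose h := trigsum s (fun v => (w ^+ 2 - v ^+ 2) * A v) (fun v => (w ^+ 2 - v ^+ 2) * B v).
have dgP x : is_derive x 1 dg (h x - w ^+ 2 * g x).
  apply: is_derive_eq; first exact: is_derive_trigsum.
  rewrite /h /g /trigsum !big_cons mulrDr opprD addrCA mulr_sumr -sumrB.
  congr (_ + _); first by ring.
  by apply: eq_bigr => v _; ring.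
have phiP x : is_derive x 1 phi (- psi x).
  by apply: is_derive_eq; rewrite /GRing.scale/= /psi; ring.
have psiP x : is_derive x 1 psi (w ^+ 2 * phi x).
  by apply: is_derive_eq; rewrite /GRing.scale/= /phi; ring.
(* The count for g comes from that for h by two integrations, each doubling it; the positive factors
   phi and phi^2 leave signs unchanged. *)
rewrite [size _]/= expnS (_ : 4 * _ = (4 ^ size s).*2.*2)%N; last first.
  by rewrite -!muln2 -mulnA mulnC.
apply: (@sign_part_eq _ (fun x => g x / phi x)).
  move=> x /phi0 px; split.
    by rewrite ler_pdivlMr// mul0r.
  by rewrite ler_pdivrMr// mul0r.
apply: (@sign_part_derive _ _ (fun x => (phi x * dg x + psi x * g x) / phi x ^+ 2)).
  move=> x /phi0 px; have ? := gP x; have ? := phiP x; have p0 := lt0r_neq0 px.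
  have ? := is_deriveV p0 (phiP x).
  apply: is_derive_eq; rewrite /GRing.scale/=; by field.
apply: (@sign_part_eq _ (fun x => phi x * dg x + psi x * g x)).
  move=> x /phi0 px; have p2 : 0 < phi x ^+ 2 by rewrite exprn_gt0.
  split; first by rewrite ler_pdivlMr// mul0r.
  by rewrite ler_pdivrMr// mul0r.
apply: (@sign_part_derive _ _ (fun x => phi x * h x)).
  move=> x _; have ? := gP x; have ? := dgP x; have ? := psiP x; have ? := phiP x.
  by apply: is_derive_eq; rewrite /GRing.scale/=; ring.
apply: (@sign_part_eq _ h) (IH _ _ _).
  by move=> x /phi0 px; rewrite pmulr_rge0// pmulr_rle0.
by move=> v vs; apply: sab; rewrite in_cons vs orbT.
Qed.

(** Differentiating once removes the constant c, at the price of one doubling. *)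
Lemma trigsum_sign_partD s A B c a b : a <= b ->
  (forall w, w \in s -> `|w| * (b - a) <= 1) ->
  sign_part (fun x => trigsum s A B x + c) (4 ^ size s).*2 a b.
Proof.
move=> ab sab; apply: (sign_part_derive _ (trigsum_sign_part _ _ ab sab)) => x _.
have ? := is_derive_trigsum s A B x.
by apply: is_derive_eq; rewrite addr0.
Qed.

End trigsum.

(** * Exponential sums *)

Section complex_facts.
Context {R : realType}.
Implicit Types (z : R[i]).

Lemma ReD z1 z2 : complex.Re (z1 + z2) = complex.Re z1 + complex.Re z2.
Proof. by case: z1; case: z2. Qed.

Lemma ImD z1 z2 : complex.Im (z1 + z2) = complex.Im z1 + complex.Im z2.
Proof. by case: z1; case: z2. Qed.

Lemma ReB z1 z2 : complex.Re (z1 - z2) = complex.Re z1 - complex.Re z2.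
Proof. by case: z1; case: z2. Qed.

Lemma ImB z1 z2 : complex.Im (z1 - z2) = complex.Im z1 - complex.Im z2.
Proof. by case: z1; case: z2. Qed.

Lemma ReM z1 z2 : complex.Re (z1 * z2) =
  complex.Re z1 * complex.Re z2 - complex.Im z1 * complex.Im z2.
Proof. by case: z1; case: z2. Qed.

Lemma ImM z1 z2 : complex.Im (z1 * z2) =
  complex.Re z1 * complex.Im z2 + complex.Im z1 * complex.Re z2.
Proof. by case: z1; case: z2. Qed.

Lemma complex_eqP z1 z2 : complex.Re z1 = complex.Re z2 ->
  complex.Im z1 = complex.Im z2 -> z1 = z2.
Proof. by case: z1; case: z2 => a b c d /= -> ->. Qed.

Lemma Re_sum (I : Type) (r : seq I) (F : I -> R[i]) :
  complex.Re (\sum_(i <- r) F i) = \sum_(i <- r) complex.Re (F i).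
Proof. by elim/big_rec2: _ => // i x z _ <-; rewrite ReD. Qed.

Lemma Im_sum (I : Type) (r : seq I) (F : I -> R[i]) :
  complex.Im (\sum_(i <- r) F i) = \sum_(i <- r) complex.Im (F i).
Proof. by elim/big_rec2: _ => // i x z _ <-; rewrite ImD. Qed.

Lemma cabsE z : cabs z = Num.sqrt (complex.Re z ^+ 2 + complex.Im z ^+ 2).
Proof. by case: z. Qed.

Lemma cabsM z1 z2 : cabs (z1 * z2) = cabs z1 * cabs z2.
Proof. exact: ComplexField.Normc.normcM. Qed.

Lemma cabsD z1 z2 : cabs (z1 + z2) <= cabs z1 + cabs z2.
Proof. exact: le_normcD. Qed.

Lemma cabsN z : cabs (- z) = cabs z.
Proof. exact: normcN. Qed.

Lemma cabs0 : cabs (0 : R[i]) = 0.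
Proof. exact: ComplexField.Normc.normc0. Qed.

Lemma cabs_ge0 z : 0 <= cabs z.
Proof. by rewrite cabsE sqrtr_ge0. Qed.

Lemma cabs_eq0 z : (cabs z == 0) = (z == 0).
Proof.
by apply/eqP/eqP => [/ComplexField.Normc.eq0_normc//|->]; exact: cabs0.
Qed.

Lemma ler_Re_cabs z : `|complex.Re z| <= cabs z.
Proof. by rewrite cabsE -sqrtr_sqr ler_sqrt ?lerDl ?addr_ge0 ?sqr_ge0. Qed.

Lemma ler_Im_cabs z : `|complex.Im z| <= cabs z.
Proof. by rewrite cabsE -sqrtr_sqr ler_sqrt ?lerDr ?addr_ge0 ?sqr_ge0. Qed.

Lemma ler_cabs_ReIm z : cabs z <= `|complex.Re z| + `|complex.Im z|.
Proof.
rewrite cabsE -[leRHS]ger0_norm ?addr_ge0// -sqrtr_sqr ler_sqrt ?sqr_ge0//.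
rewrite sqrrD !real_normK ?num_real// addrAC lerDl.
by rewrite mulrn_wge0// mulr_ge0.
Qed.

Lemma cabs_sum (I : Type) (r : seq I) (F : I -> R[i]) :
  cabs (\sum_(i <- r) F i) <= \sum_(i <- r) cabs (F i).
Proof.
elim/big_rec2: _ => [|i x z _ zx]; first by rewrite cabs0.
by rewrite (le_trans (cabsD _ _))// lerD2l.
Qed.

Lemma cabsR (c : R) : cabs c%:C = `|c|.
Proof. by rewrite cabsE /= expr0n addr0 sqrtr_sqr. Qed.

End complex_facts.

Section expsum.
Context {R : realType}.
Implicit Types (s : seq R) (a : R -> R[i]) (k v w x y : R).

Lemma chi0 x : chi 0 x = 1.
Proof. by rewrite /chi mul0r cos0 sin0. Qed.

Lemma chiD w v x : chi (w + v) x = chi w x * chi v x.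
Proof.
by rewrite /chi mulrDl cosD sinD; apply: complex_eqP => //=; rewrite addrC.
Qed.

Lemma chiDr w x y : chi w (x + y) = chi w x * chi w y.
Proof.
by rewrite /chi mulrDr cosD sinD; apply: complex_eqP => //=; rewrite addrC.
Qed.

Lemma chiN w x : chi (- w) x = conjc (chi w x).
Proof. by rewrite /chi mulNr cosN sinN. Qed.

Lemma cabs_chi w x : cabs (chi w x) = 1.
Proof. by rewrite cabsE /= cos2Dsin2 sqrtr1. Qed.

Definition expsum s a x := \sum_(w <- s) a w * chi w x.

Lemma expsum_cons w s a x : expsum (w :: s) a x = a w * chi w x + expsum s a x.
Proof. by rewrite /expsum big_cons. Qed.

Lemma Re_expsum s a x : complex.Re (expsum s a x) =
  trigsum s (fun w => complex.Re (a w)) (fun w => - complex.Im (a w)) x.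
Proof.
by rewrite Re_sum; apply: eq_bigr => w _; rewrite ReM /= mulNr.
Qed.

Lemma Im_expsum s a x : complex.Im (expsum s a x) =
  trigsum s (fun w => complex.Im (a w)) (fun w => complex.Re (a w)) x.
Proof.
by rewrite Im_sum; apply: eq_bigr => w _; rewrite ImM /= addrC.
Qed.

Definition dcoef a w : R[i] := (0 +i* w) * a w.

Lemma is_derive_Re_expsum s a x :
  is_derive x 1 (fun x => complex.Re (expsum s a x)) (complex.Re (expsum s (dcoef a) x)).
Proof.
under eq_fun do rewrite Re_expsum.
apply: is_derive_eq; first exact: is_derive_trigsum.
rewrite Re_expsum; apply: eq_bigr => w _.
by rewrite ReM ImM /= mulrN !mul0r sub0r add0r.
Qed.

Lemma is_derive_Im_expsum s a x :
  is_derive x 1 (fun x => complex.Im (expsum s a x)) (complex.Im (expsum s (dcoef a) x)).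
Proof.
under eq_fun do rewrite Im_expsum.
apply: is_derive_eq; first exact: is_derive_trigsum.
rewrite Im_expsum; apply: eq_bigr => w _.
by rewrite ReM ImM /= !mul0r sub0r add0r.
Qed.

(** Modulation preserves the modulus and brings a chosen frequency k to 0, where differentiation
    kills it. *)
Lemma expsum_shift s a k x :
  expsum [seq w - k | w <- s] (fun w => a (w + k)) x = chi (- k) x * expsum s a x.
Proof.
rewrite /expsum big_map mulr_sumr; apply: eq_bigr => w _.
by rewrite subrK addrC chiD mulrCA.
Qed.

Lemma expsum_rem0 s a x : 0 \in s ->
  expsum s (dcoef a) x = expsum (rem 0 s) (dcoef a) x.
Proof.
move=> s0; rewrite /expsum (big_rem _ s0)/= [dcoef a 0]/dcoef.
by rewrite (_ : 0 +i* 0 = 0)// !mul0r add0r.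
Qed.

(** If |f'| > 2c, then the real or the imaginary part of f' exceeds c in absolute value, and
    [outer_le_fast] applies to that real sum. *)
Lemma outer_le_expsum_fast s a (b h u c x0 : R) : 0 < h -> 0 < u -> 0 < c ->
  (forall w, w \in s -> `|w| * h <= 1) ->
  outer_le ([set x | cabs (expsum s a x) < u /\ 2 * c < cabs (expsum s (dcoef a) x)]
    `&` [set x | x0 <= x <= x0 + h]) ((4 ^ size s).*2%:R * (16 * u / c)).
Proof.
move=> h0 u0 c0 sh; set N := (_.*2).
have x0h : x0 <= x0 + h by rewrite lerDl ltW.
have PR e : sign_part (fun x => complex.Re (expsum s (dcoef a) x) + e) N x0 (x0 + h).
  under eq_fun do rewrite Re_expsum.
  by apply: trigsum_sign_partD => // w /sh; rewrite addrAC subrr add0r.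
have PI e : sign_part (fun x => complex.Im (expsum s (dcoef a) x) + e) N x0 (x0 + h).
  under eq_fun do rewrite Im_expsum.
  by apply: trigsum_sign_partD => // w /sh; rewrite addrAC subrr add0r.
have F1 := outer_le_fast u0 c0 (fun x _ => is_derive_Re_expsum s a x) (PR (- c)) (PR c).
have F2 := outer_le_fast u0 c0 (fun x _ => is_derive_Im_expsum s a x) (PI (- c)) (PI c).
have -> : N%:R * (16 * u / c) = N%:R * (8 * u / c) + N%:R * (8 * u / c) by lra.
apply: (outer_le_sub (outer_leU F1 F2)) => x [[xu xc] /= xh].
have := le_lt_trans (ler_Re_cabs _) xu; have := le_lt_trans (ler_Im_cabs _) xu => ? ?.
have := lt_le_trans xc (ler_cabs_ReIm _) => xc'.
have [?|?] := ltP c `|complex.Re (expsum s (dcoef a) x)|; [left|right]; split=> //; split=> //.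
lra.
Qed.

Lemma exists_farthest s (j : R) : s != [::] ->
  exists2 k, k \in s & forall w, w \in s -> `|j - w| <= `|j - k|.
Proof.
elim: s => // v [_ _|w s /(_ isT)[k ks kP] _].
  by exists v; rewrite ?mem_head// => w; rewrite inE => /eqP ->.
have [vk|kv] := leP `|j - v| `|j - k|.
  exists k; first by rewrite in_cons ks orbT.
  by move=> u; rewrite in_cons => /predU1P[->//|]; exact: kP.
exists v; first exact: mem_head.
move=> u; rewrite in_cons => /predU1P[->//|/kP]; move=> /le_trans; apply; exact: ltW.
Qed.

(** C depends on n alone; the frequencies enter only through L0. Asking for a coefficient of size at
    least H at one frequency j, instead of for the height, lets the induction follow j to j - k. *)
Lemma expsum_sublevel n : exists2 C : R, 0 <= C &
  forall s a (j H : R), uniq s -> size s = n.+1 -> j \in s -> 0 < H -> H <= cabs (a j) ->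
  exists L0 : R, forall L t, L0 <= L -> 0 < t ->
  outer_le ([set x | cabs (expsum s a x) < H * t ^+ n] `&` [set x | - L <= x <= L])
    (C * L * t).
Proof.
elim: n => [|n [C C0 IH]].
  (* A single term has constant modulus at least H, so the set is empty. *)
  exists 0 => // -[//|j' [|//]] a j H _ _; rewrite inE => /eqP -> H0 Ha.
  exists 0 => L t _ _; apply: (outer_leW (m := 0)); first by rewrite !mul0r.
  apply: (outer_le_sub outer_le0) => x [/= + _].
  by rewrite expsum_cons /expsum big_nil addr0 cabsM cabs_chi !mulr1 ltNge Ha.
pose N : R := (4 ^ n.+2).*2%:R.
have N0 : 0 <= N by exact: ler0n.
exists (C + 384 * N); first lra.
move=> s a j H us ss js H0 Ha.
have [|k ks kP] := @exists_farthest s j; first by case: s ss {us js}.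
pose b := `|j - k|.
(* If b vanished, all frequencies would equal j, but there are at least two. *)
have b0 : 0 < b.
  rewrite normr_gt0 subr_eq0; apply/eqP => jk.
  have : (size s <= size [:: j])%N; last by rewrite ss.
  apply: uniq_leq_size => // w /kP; rewrite jk subrr normr0 normr_le0 subr_eq0.
  by rewrite inE eq_sym.
pose s1 := [seq w - k | w <- s]; pose a1 w := a (w + k).
have s10 : 0 \in s1 by apply/mapP; exists k; rewrite ?subrr.
have us1 : uniq s1 by rewrite map_inj_uniq//; exact: addIr.
have [|||||L1 L1P] := IH (rem 0 s1) (dcoef a1) (j - k) (H * b).
- exact: rem_uniq.
- by rewrite size_rem// size_map ss.
- rewrite mem_rem_uniq// inE -normr_gt0 b0/=; exact: map_f.
- by rewrite mulr_gt0.
- rewrite /dcoef /a1 subrK cabsM mulrC ler_pM ?(ltW b0) ?(ltW H0)//.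
  by rewrite cabsE /= expr0n add0r sqrtr_sqr.
(* After the shift every frequency has size at most 2b, by the triangle inequality through j. *)
pose h := (2 * b)^-1.
have h0 : 0 < h by rewrite invr_gt0 mulr_gt0.
exists (Num.max L1 h) => L t; rewrite ge_max => /andP[L1L hL] t0.
have {}L1P := L1P L t L1L t0.
have tn : 0 < t ^+ n by rewrite exprn_gt0.
(* Here 2c is strictly below H b t^n, the level of the induction hypothesis. Then 16u/c = 64t/b and
   3L/h = 6bL, whence the 384. *)
pose u := H * t ^+ n.+1; pose c := H * b * t ^+ n / 4.
have u0 : 0 < u by rewrite mulr_gt0 ?exprn_gt0.
have c0 : 0 < c by rewrite divr_gt0// !mulr_gt0.
have s1h w : w \in s1 -> `|w| * h <= 1.
  move=> /mapP[v vs ->]; rewrite ler_pdivrMr ?mulr_gt0// mul1r.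
  have -> : v - k = (j - k) - (j - v) by ring.
  by rewrite (le_trans (ler_normB _ _))// mulr2n mulrDl !mul1r lerD ?kP.
have F := outer_le_long _ (fun x0 => outer_le_expsum_fast a1 b x0 h0 u0 c0 s1h).
have {}F := F L; rewrite h0 hL in F; have {}F := F isT.
apply: (outer_le_sub (outer_leW _ (outer_leU L1P F))).
  rewrite (_ : (C + 384 * N) * L * t = C * L * t + 384 * N * L * t); last by ring.
  rewrite lerD2l size_map ss -/N /h /u /c exprS.
  rewrite le_eqVlt; apply/orP; left; apply/eqP; field.
  by rewrite !gt_eqF.
move=> x [/= xu xL].
have xu1 : cabs (expsum s1 a1 x) < u by rewrite expsum_shift cabsM cabs_chi mul1r.
have [xc|xc] := ltP (cabs (expsum (rem 0 s1) (dcoef a1) x)) (H * b * t ^+ n);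
  [left|right]; split=> //=; split=> //.
by rewrite expsum_rem0//; apply: lt_le_trans xc; rewrite /c in c0 *; lra.
Qed.

End expsum.

(** * Density bounds and part (ii) *)

Lemma mean_measure_le (R : realType) (S : set R) (m : R) : 0 <= m ->
  (exists L0, forall L, L0 <= L -> outer_le (S `&` [set x | - L <= x <= L]) (2 * L * m)) ->
  mean_measure S <= m.
Proof.
move=> m0 [L0 SL]; rewrite /mean_measure; set F := (F in lim F).
(* Without a limit, [lim] is 0, which is at most m. *)
have [cF|dF] := pselect (cvg F); last by rewrite (dvgP dF).
apply: limr_le => //; near=> L.
have L1 : 0 < L by near: L; apply: nbhs_pinfty_gt; exact: num_real.
have L2 : L0 <= L by near: L; apply: nbhs_pinfty_ge; exact: num_real.
rewrite mulrC ler_pdivrMr ?mulr_gt0// -lee_fin mulrC.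
have -> : `[- L, L]%classic `&` S = S `&` [set x | - L <= x <= L].
  by rewrite setIC; congr (_ `&` _); apply/seteqP; split => x /=; rewrite in_itv.
have := SL L L2; rewrite /outer_le => SLm.
by rewrite fineK// ge0_fin_numE// (le_lt_trans SLm) ?ltry.
Unshelve. all: by end_near.
Qed.

Section mean_measure_bounds.
Context {R : realType}.

Lemma mean_measure_le1 (S : set R) : mean_measure S <= 1.
Proof.
apply: mean_measure_le => //; exists 0 => L L0; rewrite mulr1.
have -> : 2 * L = L - - L by ring.
by apply: (outer_le_sub (outer_le_itv _)) => [|x []//]; lra.
Qed.

(** The change of variable that turns a bound O(t) for {|f| < H t^n} into the required power of
    u. *)
Lemma power_sublevel (n : nat) (H u : R) : (0 < n)%N -> 0 < H -> 0 < u ->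
  exists2 t, 0 < t & u = H * t ^+ n /\ t = H `^ (- n%:R^-1) * u `^ n%:R^-1.
Proof.
move=> n0 H0 u0; exists (H `^ (- n%:R^-1) * u `^ n%:R^-1).
  by rewrite mulr_gt0// powR_gt0.
split=> //; rewrite exprMn -!powR_mulrn ?powR_ge0// -!powRrM mulNr mulVf ?pnatr_eq0 -?lt0n//.
by rewrite powRN !powRr1 ?ltW// mulrA divff ?mul1r ?gt_eqF.
Qed.

Lemma bigmax_attained (s : seq R) (F : R -> R) : s != [::] -> (forall w, 0 <= F w) ->
  exists2 j, j \in s & \big[Num.max/0]_(w <- s) F w = F j.
Proof.
move=> + F0; elim: s => // v [_ _|w s /(_ isT)[j js jP] _].
  by exists v; rewrite ?mem_head// big_cons big_nil (max_idPl _).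
rewrite big_cons jP maxEle; case: ifP => _; last by exists v; rewrite ?mem_head.
by exists j; rewrite // in_cons js orbT.
Qed.

End mean_measure_bounds.

Theorem trigpoly_sublevel (R : realType) : exists C : nat -> R, forall n : nat, (1 <= n)%N ->
     forall a : trigpoly R, #|` finsupp a| = n.+1 ->
     forall u : R, 0 < u ->
       J (trigpoly_fun a) u <=
         C n * height a `^ (- n%:R^-1) * u `^ n%:R^-1.
Proof.
have CP n := cid2 (@expsum_sublevel R n).
exists (fun n => sval (CP n)) => n n0 a an u u0.
case: (CP n) => C /= C0 {}CP.
have [j ja Hj] : exists2 j, j \in finsupp a & height a = cabs (a j).
  by apply: bigmax_attained => [|w]; rewrite ?cabs_ge0// -size_eq0 an.
have H0 : 0 < height a.
  by rewrite Hj lt_neqAle cabs_ge0 andbT eq_sym cabs_eq0 -mem_finsupp.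
have [t t0 [ut tE]] := power_sublevel n0 H0 u0.
rewrite -mulrA -tE.
have := CP (finsupp a) a j (height a) (fset_uniq _) an ja H0.
rewrite Hj lexx => /(_ isT)[L0 L0P].
apply: mean_measure_le; first by rewrite mulr_ge0// ltW.
(* L >= 0 allows passing from C L t to 2 L (C t). *)
exists (Num.max L0 0) => L; rewrite ge_max => /andP[L0L LL].
apply: (outer_leW _ (outer_le_sub (L0P L t L0L t0) _)).
  by have := mulr_ge0 (mulr_ge0 C0 LL) (ltW t0); lra.
by move=> x [+ xL]; split=> //; rewrite /= -Hj -ut.
Qed.

(** * Bernstein's inequality *)

Section bernstein.
Context {R : realType}.
Implicit Types (s : seq R) (A B : R -> R) (x y w : R).

(* [arcsin_coef k] is 'C(2k, k) / 4^k, so that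
   arcsin y = \sum_k arcsin_coef k / (2k+1) y^(2k+1). *)
Fixpoint arcsin_coef k : R :=
  if k is k'.+1 then arcsin_coef k' * (2 * k' + 1)%:R / (2 * k' + 2)%:R else 1.

Lemma arcsin_coefS k :
  (2 * k + 2)%:R * arcsin_coef k.+1 = (2 * k + 1)%:R * arcsin_coef k.
Proof. by rewrite /= mulrCA mulfV ?mulr1 1?mulrC// pnatr_eq0 addn2. Qed.

Lemma arcsin_coef_itv k : 0 < arcsin_coef k <= 1.
Proof.
elim: k => [|k /andP[k0 k1]] /=; first by rewrite ltr01 lexx.
have k2 : 0 < (2 * k + 2)%:R :> R by rewrite ltr0n addn2.
apply/andP; split; first by rewrite divr_gt0// mulr_gt0// ltr0n addn1.
rewrite ler_pdivrMr// mul1r.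
rewrite (le_trans (y := 1 * (2 * k + 1)%:R))//; first by rewrite ler_wpM2r.
by rewrite mul1r ler_nat leq_add2l.
Qed.

Definition arcsin_psum K (z : R) : R :=
  \sum_(k < K.+1) arcsin_coef k / (2 * k + 1)%:R * z ^+ (2 * k + 1).

(** Partial sums of (1 - z^2)^(-1/2). *)
Definition darcsin_psum K (z : R) : R := \sum_(k < K.+1) arcsin_coef k * z ^+ (2 * k).

Lemma is_derive_sinX n y :
  is_derive y 1 (fun y : R => sin y ^+ n.+1) (n.+1%:R * sin y ^+ n * cos y).
Proof.
have := is_deriveX n.+1 (is_derive_sin y).
by rewrite (_ : sin ^+ n.+1 = fun y => sin y ^+ n.+1)//; apply/funext => t; rewrite exprfctE.
Qed.

Lemma is_derive_arcsin_psum K y :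
  is_derive y 1 (fun y => arcsin_psum K (sin y)) (darcsin_psum K (sin y) * cos y).
Proof.
elim: K => [|K IH].
  rewrite /darcsin_psum big_ord1 mul1r expr0 mul1r.
  under eq_fun do rewrite /arcsin_psum big_ord1 divr1 mul1r expr1.
  exact: is_derive_sin.
have -> : (fun y => arcsin_psum K.+1 (sin y)) = (fun y => arcsin_psum K (sin y) +
    arcsin_coef K.+1 / (2 * K.+1 + 1)%:R * sin y ^+ (2 * K.+1 + 1)).
  by apply/funext => t; rewrite /arcsin_psum big_ord_recr.
set c := _ / _; rewrite addn1.
have ? := is_derive_sinX (2 * K.+1) y.
apply: is_derive_eq.
rewrite /darcsin_psum [in RHS]big_ord_recr [in RHS]mulrDl; congr (_ + _).
transitivity (c * ((2 * K.+1).+1%:R * sin y ^+ (2 * K.+1) * cos y)); first by [].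
rewrite !mulrA; congr (_ * _ * _).
by rewrite /c addn1 mulfVK// pnatr_eq0.
Qed.

(** The function is the derivative of the error y - arcsin_psum K (sin y). By the recurrence for the
    coefficients and cos^2 = 1 - sin^2, its own derivative telescopes to one monomial, which
    controls the error without summing the series. *)
Lemma is_derive_darcsin_psum_cos K y :
  is_derive y 1 (fun y => 1 - darcsin_psum K (sin y) * cos y)
    ((2 * K + 1)%:R * arcsin_coef K * sin y ^+ (2 * K + 1)).
Proof.
elim: K => [|K IH].
  under eq_fun do rewrite /darcsin_psum big_ord1 mul1r expr0 mul1r.
  by apply: is_derive_eq; rewrite muln0 add0n [arcsin_coef 0]/=; ring.
have -> : (fun y => 1 - darcsin_psum K.+1 (sin y) * cos y) =
    (fun y => (1 - darcsin_psum K (sin y) * cos y) -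
      arcsin_coef K.+1 * (sin y ^+ (2 * K.+1) * cos y)).
  by apply/funext => t; rewrite /darcsin_psum big_ord_recr/= mulrDl opprD addrA mulrA.
rewrite (_ : (2 * K.+1)%N = (2 * K + 1).+1); last by lia.
have ? := is_derive_sinX (2 * K + 1) y.
apply: is_derive_eq; rewrite -arcsin_coefS addn1 addn2 addn1.
move: (arcsin_coef K.+1) (2 * K)%N => c n.
rewrite -[n.+3%:R]natr1 !(exprS _ n.+2) !(exprS _ n.+1).
have cs : cos y * cos y = 1 - sin y * sin y.
  by rewrite -(cos2Dsin2 y) !expr2 addrK.
set z := sin y ^+ n.+1; set m := n.+2%:R.
transitivity (m * c * z - c * (sin y * z * - sin y + m * z * (cos y * cos y))).
  by rewrite /GRing.scale /=; ring.
by rewrite cs; ring.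
Qed.

Lemma sin_le y : 0 <= y -> sin y <= y.
Proof.
move=> y0; rewrite -subr_ge0.
have /derive_ndecr H : forall x, 0 <= x <= y -> is_derive x 1 (fun y : R => y - sin y) (1 - cos x).
  by move=> x _; exact: is_deriveB.
have := H _ 0 y; rewrite sin0 subr0; apply => // x _; by rewrite subr_ge0 cos_le1.
Qed.

(** Two integrations from 0: r' >= 0 makes r and the error nonnegative. If y <= 1/2, then sin <= 1/2
    on [0, y] bounds r' by a constant, and integrating over an interval shorter than 1 keeps that
    bound. *)
Lemma arcsin_psum_sin_le K y : 0 <= y <= pi / 2 ->
  0 <= y - arcsin_psum K (sin y) /\
  (y <= 2^-1 -> y - arcsin_psum K (sin y) <= (2 * K + 1)%:R / 2 ^+ (2 * K + 1)).
Proof.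
move=> /andP[y0 y1]; pose r x := 1 - darcsin_psum K (sin x) * cos x.
have dr x := is_derive_darcsin_psum_cos K x.
have dq x : is_derive x 1 (fun x => x - arcsin_psum K (sin x)) (r x).
  by have ? := is_derive_arcsin_psum K x; exact: is_deriveB.
have r0 : r 0 = 0.
  rewrite /r sin0 cos0 mulr1 /darcsin_psum big_ord_recl big1 ?addr0 ?mulr1 ?subrr//.
  by move=> i _; rewrite expr0n mulr0.
have q0 : 0 - arcsin_psum K (sin 0) = 0.
  rewrite sub0r sin0 /arcsin_psum big1 ?oppr0// => i _.
  by rewrite expr0n addn1 mulr0.
have sin0y x : 0 <= x <= y -> 0 <= sin x by move=> ?; apply: sin_ge0_pi; have := pihalf_ge1; lra.
have /andP[c0 c1] := arcsin_coef_itv K.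
have r_ge0 x : 0 <= x <= y -> 0 <= r x.
  move=> /andP[x0 xy]; rewrite -r0.
  apply: (derive_ndecr (fun x (_ : 0 <= x <= y) => dr x)) => // t ty.
  by rewrite !mulr_ge0 ?(ltW c0) ?exprn_ge0 ?sin0y ?ler0n.
split.
  rewrite -q0.
  exact: (derive_ndecr (fun x (_ : 0 <= x <= y) => dq x) r_ge0).
move=> y2; set e := (_ / _).
have e0 : 0 <= e by rewrite divr_ge0.
have r_le x : 0 <= x <= y -> r x <= e.
  move=> /andP[x0 xy].
  have drc (t : R) : is_derive t 1 (fun t => e * t - r t)
      (e - (2 * K + 1)%:R * arcsin_coef K * sin t ^+ (2 * K + 1)).
    have ? := dr t; apply: is_derive_eq; by rewrite /GRing.scale/= mulr1.
  have := derive_ndecr (fun x (_ : 0 <= x <= y) => drc x) _ (lexx 0) x0 xy.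
  rewrite r0 mulr0 subrr => H.
  suff : 0 <= e * x - r x by nra.
  apply: H => t /andP[t0 ty].
  rewrite subr_ge0 /e -mulrA ler_wpM2l// -[leRHS]mul1r ler_pM ?(ltW c0) ?exprn_ge0 ?sin0y ?t0//.
  by rewrite -exprVn lerXn2r ?nnegrE ?sin0y ?t0// (le_trans (sin_le _))//; lra.
have dqc (t : R) : is_derive t 1 (fun t => e * t - (t - arcsin_psum K (sin t))) (e - r t).
  have ? := dq t; apply: is_derive_eq; by rewrite /GRing.scale/= mulr1.
have := derive_ndecr (fun x (_ : 0 <= x <= y) => dqc x) _ (lexx 0) y0 (lexx y).
rewrite q0 mulr0 subrr => H.
suff : 0 <= e * y - (y - arcsin_psum K (sin y)) by nra.
by apply: H => t /r_le; rewrite subr_ge0.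
Qed.

(** At y = pi/2, where sin is 1, a nonnegative error bounds the total weight of the coefficients by
    pi/2. *)
Lemma arcsin_psum1 K : arcsin_psum K 1 <= 2.
Proof.
have [] := @arcsin_psum_sin_le K (pi / 2).
  by rewrite lexx andbT divr_ge0// pi_ge0.
by rewrite sin_pihalf subr_ge0 => /le_trans + _; apply; exact/ltW/pihalf_lt2.
Qed.

Lemma arcsin_psumN K z : arcsin_psum K (- z) = - arcsin_psum K z.
Proof.
rewrite /arcsin_psum -sumrN; apply: eq_bigr => k _.
by rewrite exprNn addn1 exprS exprM sqrrN expr1n expr1n mulr1 mulN1r mulrN.
Qed.

Lemma arcsin_psum_err K y : `|y| <= 2^-1 ->
  `|y - arcsin_psum K (sin y)| <= (2 * K + 1)%:R / 2 ^+ (2 * K + 1).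
Proof.
wlog y0 : y / 0 <= y => [wl|].
  have [/wl//|/ltW] := leP 0 y; rewrite -oppr_ge0 => /wl; rewrite normrN.
  by rewrite sinN arcsin_psumN -opprD normrN.
rewrite ger0_norm// => y2; have [|q0 q1] := @arcsin_psum_sin_le K y.
  by rewrite y0/=; have := @pihalf_ge1 R; lra.
by rewrite ger0_norm ?q1.
Qed.

Lemma arcsin_err_small (e : R) : 0 < e -> exists K, (2 * K + 1)%:R / 2 ^+ (2 * K + 1) <= e.
Proof.
move=> e0; exists (Num.truncn e^-1); set K := Num.truncn _.
have : e^-1 < K.+1%:R by have /andP[] := @truncn_itv R e^-1 (ltW (etrans (invr_gt0 _) e0)).
rewrite -[X in X < _]mul1r ltr_pdivrMr// => Ke.
rewrite ler_pdivrMr ?exprn_gt0//.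
(* This makes the error at most 1/(K+1), which is below e. *)
have : ((2 * K + 1) * K.+1 <= 2 ^ (2 * K + 1))%N.
  elim: (K) => // -[//|k IH].
  have -> : (2 ^ (2 * k.+2 + 1) = 4 * 2 ^ (2 * k.+1 + 1))%N by rewrite mulnS -addnA expnD.
  apply: leq_trans (leq_mul (leqnn 4) IH); nia.
rewrite -(ler_nat R) natrM natrX => H.
have K0 : 0 <= (2 * K + 1)%:R :> R by [].
have : (2 * K + 1)%:R * 1 <= (2 * K + 1)%:R * (K.+1%:R * e) by rewrite ler_wpM2l// ltW.
rewrite mulr1 mulrA => /le_trans; apply; rewrite mulrC ler_wpM2l//; exact: ltW.
Qed.

Lemma trigsumZ s A B x (c : R) :
  trigsum s (fun w => c * A w) (fun w => c * B w) x = c * trigsum s A B x.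
Proof. by rewrite /trigsum mulr_sumr; apply: eq_bigr => w _; ring. Qed.

Lemma trigsum_diff s A B (h x : R) :
  (trigsum s A B (x + h) - trigsum s A B (x - h)) / 2 =
  trigsum s (fun w => sin (h * w) * B w) (fun w => - (sin (h * w) * A w)) x.
Proof.
rewrite /trigsum -sumrB mulr_suml; apply: eq_bigr => w _.
rewrite !mulrDr !mulrN !cosB !sinB !cosD !sinD [h * w]mulrC.
by field.
Qed.

Lemma trigsum_diff_bounded s A B (h M : R) : (forall x, `|trigsum s A B x| <= M) ->
  forall x, `|trigsum s (fun w => sin (h * w) * B w) (fun w => - (sin (h * w) * A w)) x| <= M.
Proof.
move=> gM x; rewrite -trigsum_diff normrM [ `|2^-1|]ger0_norm ?invr_ge0//.
rewrite ler_pdivrMr// (le_trans (ler_normB _ _))// mulrDr mulr1 lerD//.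
Qed.

(** Two successive differences multiply the coefficients by - sin (h w)^2; the sign disappears in
    the absolute value. *)
Lemma trigsum_diff_iter s A B (h M : R) k : (forall x, `|trigsum s A B x| <= M) ->
  forall x, `|trigsum s (fun w => sin (h * w) ^+ (2 * k + 1) * B w)
    (fun w => - (sin (h * w) ^+ (2 * k + 1) * A w)) x| <= M.
Proof.
elim: k A B => [|k IH] A B gM x; first exact: trigsum_diff_bounded.
have := trigsum_diff_bounded h (trigsum_diff_bounded h gM).
move=> /IH /(_ x); rewrite -normrN -mulN1r -trigsumZ; apply: le_trans.
rewrite le_eqVlt; apply/orP; left; apply/eqP; congr `|_|; apply: eq_bigr => w _.
have -> : (2 * k.+1 + 1)%N = (2 * k + 1).+2 by lia.
by rewrite !exprS; ring.
Qed.

(* On |w| <= W, the multiplier h w, with h = 1 / (2W), is the arcsin series of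
   sin (h w), and sin (h w) is up to the factor 'i the multiplier of the symmetric
   difference (g (x + h) - g (x - h)) / 2, which has norm at most 1. *)
Theorem trigsum_bernstein s A B (W M : R) : 0 < W -> (forall w, w \in s -> `|w| <= W) ->
  (forall x, `|trigsum s A B x| <= M) ->
  forall x, `|trigsum s (fun w => w * B w) (fun w => - (w * A w)) x| <= 4 * W * M.
Proof.
move=> W0 sW gM x; pose h := (2 * W)^-1.
have h0 : 0 < h by rewrite invr_gt0 mulr_gt0.
rewrite -[X in `|X|](mulKf (lt0r_neq0 h0)) normrM normfV (gtr0_norm h0).
rewrite ler_pdivrMl// (_ : h * (4 * W * M) = 2 * M); last by rewrite /h; field; exact: lt0r_neq0.
set S := \sum_(w <- s) (`|A w| + `|B w|).
have S0 : 0 <= S by apply: sumr_ge0 => w _; rewrite addr_ge0.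
rewrite -trigsumZ; apply/ler_addgt0Pr => e e0.
(* K may depend on the sum through S: it affects only the tail, which is absorbed by the arbitrary
   e. *)
have [K Ke] : exists K, S * ((2 * K + 1)%:R / 2 ^+ (2 * K + 1)) <= e.
  have [K Ke] := @arcsin_err_small (e / (S + 1)) ltac:(by rewrite divr_gt0// ltr_wpDl).
  exists K; apply: le_trans (ler_wpM2l S0 Ke) _.
  by rewrite mulrCA ler_piMr ?(ltW e0)// ler_pdivrMr ?ltr_wpDl// mul1r lerDl.
pose P w := arcsin_psum K (sin (h * w)).
have -> : trigsum s (fun w => h * (w * B w)) (fun w => h * - (w * A w)) x =
    trigsum s (fun w => P w * B w) (fun w => - (P w * A w)) x +
    trigsum s (fun w => (h * w - P w) * B w) (fun w => - ((h * w - P w) * A w)) x.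
  by rewrite /trigsum -big_split; apply: eq_bigr => w _ /=; ring.
apply: le_trans (ler_normD _ _) (lerD _ (le_trans _ Ke)).
  have -> : trigsum s (fun w => P w * B w) (fun w => - (P w * A w)) x =
    \sum_(k < K.+1) arcsin_coef k / (2 * k + 1)%:R *
    trigsum s (fun w => sin (h * w) ^+ (2 * k + 1) * B w)
      (fun w => - (sin (h * w) ^+ (2 * k + 1) * A w)) x.
    under eq_bigr do rewrite mulr_sumr.
    rewrite exchange_big; apply: eq_bigr => w _ /=.
    transitivity (P w * (B w * cos (w * x) - A w * sin (w * x))); first by ring.
    rewrite /P /arcsin_psum mulr_suml.
    by apply: eq_bigr => k _; ring.
  apply: le_trans (ler_norm_sum _ _ _) _.
  have M0 : 0 <= M := le_trans (normr_ge0 _) (gM 0).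
  apply: le_trans (ler_wpM2r M0 (arcsin_psum1 K)).
  rewrite /arcsin_psum mulr_suml; apply: ler_sum => k _.
  have /andP[c0 _] := arcsin_coef_itv k.
  have d0 : 0 <= arcsin_coef k / (2 * k + 1)%:R by rewrite divr_ge0// ltW.
  rewrite normrM ger0_norm// expr1n mulr1 ler_wpM2l//; exact: trigsum_diff_iter.
apply: le_trans (ler_norm_sum _ _ _) _; rewrite /S mulr_suml big_seq [leRHS]big_seq.
apply: ler_sum => w ws.
have /(arcsin_psum_err K) : `|h * w| <= 2^-1.
  by rewrite normrM gtr0_norm// /h invfM -mulrA ler_piMr ?invr_ge0// ler_pdivrMl// mulr1 sW.
rewrite -/(P w) => Pw.
have bnd (c t : R) : `|t| <= 1 -> `|(h * w - P w) * c * t| <= `|c| * ((2 * K + 1)%:R / 2 ^+ (2 * K + 1)).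
  move=> t1; rewrite 2!normrM -[leRHS]mulr1 [ `|_| * `|c|]mulrC.
  by rewrite ler_pM ?mulr_ge0// ler_wpM2l.
apply: le_trans (ler_normD _ _) _; rewrite [leRHS]mulrDl [leRHS]addrC lerD//.
  exact: bnd (cos_max _).
by rewrite mulNr normrN; exact: bnd (sin_max _).
Qed.

End bernstein.

(** * Means of almost periodic functions *)

Section real_mean.
Context {R : realType}.
Implicit Types (g : R -> R) (m c L : R).

Definition average g L := (2 * L)^-1 * Rintegral lebesgue_measure `[- L, L] g.

Definition has_mean g m := average g L @[L --> +oo] --> m.

Lemma continuous_integrable g L : continuous g ->
  lebesgue_measure.-integrable `[- L, L] (EFin \o g).
Proof.
move=> cg; apply: continuous_compact_integrable; first exact: segment_compact.
exact: continuous_subspaceT.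
Qed.

Lemma averageD g1 g2 L : continuous g1 -> continuous g2 ->
  average (fun x => g1 x + g2 x) L = average g1 L + average g2 L.
Proof.
by move=> c1 c2; rewrite /average RintegralD ?mulrDr//; exact: continuous_integrable.
Qed.

Lemma averageZ c g L : continuous g -> average (fun x => c * g x) L = c * average g L.
Proof.
move=> cg; rewrite /average RintegralZl; [exact: mulrCA|by []|].
exact: continuous_integrable.
Qed.

Lemma average_cst c L : 0 < L -> average (fun=> c) L = c.
Proof.
move=> L0; rewrite /average Rintegral_cst//= lebesgue_measure_itv/= lte_fin.
rewrite ifT; last by lra.
rewrite -EFinB /=; field; lra.
Qed.

Lemma le_average g1 g2 L : 0 < L -> continuous g1 -> continuous g2 ->
  (forall x, g1 x <= g2 x) -> average g1 L <= average g2 L.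
Proof.
move=> L0 c1 c2 g12; rewrite /average ler_wpM2l ?invr_ge0 ?mulr_ge0 ?(ltW L0)//.
by apply: le_Rintegral => //; exact: continuous_integrable.
Qed.

Lemma has_meanD g1 g2 m1 m2 : continuous g1 -> continuous g2 ->
  has_mean g1 m1 -> has_mean g2 m2 -> has_mean (fun x => g1 x + g2 x) (m1 + m2).
Proof.
move=> c1 c2 h1 h2; rewrite /has_mean; under eq_fun do rewrite averageD//.
exact: cvgD h1 h2.
Qed.

Lemma has_meanZ c g m : continuous g -> has_mean g m ->
  has_mean (fun x => c * g x) (c * m).
Proof.
move=> cg h; rewrite /has_mean; under eq_fun do rewrite averageZ//.
exact: cvgMr h.
Qed.

Lemma has_mean_le g1 g2 m1 m2 : continuous g1 -> continuous g2 ->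
  (forall x, g1 x <= g2 x) -> has_mean g1 m1 -> has_mean g2 m2 -> m1 <= m2.
Proof.
move=> c1 c2 g12 h1 h2; apply: (ler_cvg_to h1 h2); near=> L.
by apply: le_average => //; near: L; apply: nbhs_pinfty_gt; exact: num_real.
Unshelve. all: by end_near.
Qed.

Lemma has_mean_cst c : has_mean (fun=> c) c.
Proof.
apply/cvgrPdist_le => e e0; near=> L.
rewrite average_cst; first by rewrite subrr normr0 ltW.
by near: L; apply: nbhs_pinfty_gt; exact: num_real.
Unshelve. all: by end_near.
Qed.

(** The integral over [-L, L] is G L - G (-L), so the averages are at most K/L. *)
Lemma has_mean_derive g (G : R -> R) (K : R) : continuous g -> (forall x : R, is_derive x 1 G (g x)) ->
  (forall x, `|G x| <= K) -> has_mean g 0.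
Proof.
move=> cg GP GK; have K0 : 0 <= K := le_trans (normr_ge0 _) (GK 0).
have cG : continuous G.
  move=> x; apply/differentiable_continuous/derivable1_diffP.
  exact: (@ex_derive _ _ _ _ _ _ _ (GP x)).
apply/cvgrPdist_le => e e0; near=> L.
have L0 : 0 < L by near: L; apply: nbhs_pinfty_gt; exact: num_real.
have LK : K / e <= L by near: L; apply: nbhs_pinfty_ge; exact: num_real.
rewrite sub0r normrN /average /Rintegral (@continuous_FTC2 _ _ G).
- rewrite -EFinB /= normrM gtr0_norm ?invr_gt0 ?mulr_gt0//.
  rewrite ler_pdivrMl ?mulr_gt0// (le_trans (ler_normB _ _))//.
  have := GK L; have := GK (- L); move: LK; rewrite ler_pdivrMr// => LK ? ?; lra.
- lra.
- exact: continuous_subspaceT.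
- split=> [x _| |].
  + exact: (@ex_derive _ _ _ _ _ _ _ (GP x)).
  + apply: cvg_at_right_filter; exact: cG.
  + apply: cvg_at_left_filter; exact: cG.
- by move=> x _; rewrite derive1E; exact: (@derive_val _ _ _ _ _ _ _ (GP x)).
Unshelve. all: by end_near.
Qed.

(** The averages of g are within e/2 of those of g', hence eventually within e of m; completeness of
    the line concludes. *)
Lemma has_mean_approx g : continuous g ->
  (forall e, 0 < e -> exists g' m, [/\ continuous g', has_mean g' m &
    forall x, `|g x - g' x| <= e]) ->
  exists m, has_mean g m.
Proof.
move=> cg happ; apply/cvg_ex/cauchy_cvgP/cauchy_exP => e e0.
have e2 : 0 < e / 2 by rewrite divr_gt0.
have [g' [m [cg' hm gg']]] := happ _ e2.
exists m; suff : \forall L \near +oo, ball m e (average g L) by [].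
near=> L.
have L0 : 0 < L by near: L; apply: nbhs_pinfty_gt; exact: num_real.
have mL : `|m - average g' L| < e / 2 by near: L; move/cvgrPdist_lt : hm; exact.
rewrite /ball/= -[m](subrK (average g' L)) -addrA [e]splitr.
rewrite (le_lt_trans (ler_normD _ _))// ltr_leD// distrC ler_norml; apply/andP; split.
  rewrite lerBrDl -[X in _ + X](@average_cst _ L)// -averageD//; last by move=> ?; exact: cst_continuous.
  apply: le_average => // [x|x]; first by apply: cvgD; [exact: cg'|exact: cst_continuous].
  by have := gg' x; rewrite ler_norml; lra.
rewrite lerBlDl -[X in _ + X](@average_cst _ L)// -averageD//; last by move=> ?; exact: cst_continuous.
apply: le_average => // [x|x]; first by apply: cvgD; [exact: cg'|exact: cst_continuous].
by have := gg' x; rewrite ler_norml; lra.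
Unshelve. all: by end_near.
Qed.

Lemma has_mean_cos (w : R) : has_mean (fun x => cos (w * x)) (w == 0)%:R.
Proof.
have [->|w0] := eqVneq w 0.
  by under eq_fun do rewrite mul0r cos0; exact: has_mean_cst.
apply: (@has_mean_derive _ (fun x => w^-1 * sin (w * x)) `|w^-1|).
- move=> x; apply/differentiable_continuous/derivable1_diffP.
  have h : is_derive x 1 (fun x : R => cos (w * x)) (- (w * sin (w * x))).
    by apply: is_derive_eq; rewrite /GRing.scale/=; ring.
  exact: (@ex_derive _ _ _ _ _ _ _ h).
- move=> x; apply: is_derive_eq; rewrite /GRing.scale/=.
  by field.
- by move=> x; rewrite normrM ler_piMr// sin_max.
Qed.

Lemma has_mean_sin (w : R) : has_mean (fun x => sin (w * x)) 0.
Proof.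
have [->|w0] := eqVneq w 0.
  by under eq_fun do rewrite mul0r sin0; exact: has_mean_cst.
apply: (@has_mean_derive _ (fun x => - w^-1 * cos (w * x)) `|w^-1|).
- move=> x; apply/differentiable_continuous/derivable1_diffP.
  have h : is_derive x 1 (fun x : R => sin (w * x)) (w * cos (w * x)).
    by apply: is_derive_eq; rewrite /GRing.scale/=; ring.
  exact: (@ex_derive _ _ _ _ _ _ _ h).
- move=> x; apply: is_derive_eq; rewrite /GRing.scale/=.
  by field.
- by move=> x; rewrite normrM normrN ler_piMr// cos_max.
Qed.

End real_mean.

(** * Complex means and Fourier coefficients *)

Section complex_mean.
Context {R : realType}.
Implicit Types (f g : R -> R[i]) (z : R[i]) (w x : R).

(** Continuity and means are taken componentwise, so that the real integration lemmas apply. *)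
Definition ccontinuous f :=
  continuous (fun x => complex.Re (f x)) /\ continuous (fun x => complex.Im (f x)).

Definition has_cmean f z :=
  has_mean (fun x => complex.Re (f x)) (complex.Re z) /\
  has_mean (fun x => complex.Im (f x)) (complex.Im z).

Lemma ccontinuousD f g : ccontinuous f -> ccontinuous g ->
  ccontinuous (fun x => f x + g x).
Proof.
move=> [f1 f2] [g1 g2]; split=> x.
  by under eq_fun do rewrite ReD; apply: cvgD; [exact: f1|exact: g1].
by under eq_fun do rewrite ImD; apply: cvgD; [exact: f2|exact: g2].
Qed.

Lemma ccontinuousM f g : ccontinuous f -> ccontinuous g ->
  ccontinuous (fun x => f x * g x).
Proof.
move=> [f1 f2] [g1 g2]; split=> x.
  under eq_fun do rewrite ReM; apply: cvgB; apply: cvgM;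
  by [exact: f1|exact: g1|exact: f2|exact: g2].
under eq_fun do rewrite ImM; apply: cvgD; apply: cvgM;
by [exact: f1|exact: g1|exact: f2|exact: g2].
Qed.

Lemma ccontinuous_cst z : ccontinuous (fun=> z).
Proof. by split=> x; exact: cvg_cst. Qed.

Lemma ccontinuous_sum (I : Type) (r : seq I) (F : I -> R -> R[i]) :
  (forall i, ccontinuous (F i)) -> ccontinuous (fun x => \sum_(i <- r) F i x).
Proof.
move=> cF; elim: r => [|i r IH].
  by under eq_fun do rewrite big_nil; exact: ccontinuous_cst.
by under eq_fun do rewrite big_cons; exact: ccontinuousD.
Qed.

Lemma ccontinuous_chi w : ccontinuous (chi w).
Proof.
split=> x; rewrite /chi/=; apply/differentiable_continuous/derivable1_diffP.
  have h : is_derive x 1 (fun x : R => cos (w * x)) (- (w * sin (w * x))).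
    by apply: is_derive_eq; rewrite /GRing.scale/=; ring.
  exact: (@ex_derive _ _ _ _ _ _ _ h).
have h : is_derive x 1 (fun x : R => sin (w * x)) (w * cos (w * x)).
  by apply: is_derive_eq; rewrite /GRing.scale/=; ring.
exact: (@ex_derive _ _ _ _ _ _ _ h).
Qed.

Lemma ccontinuous_expsum s (a : R -> R[i]) : ccontinuous (expsum s a).
Proof.
apply: ccontinuous_sum => w; apply: ccontinuousM; first exact: ccontinuous_cst.
exact: ccontinuous_chi.
Qed.

Lemma has_cmeanD f g z1 z2 : ccontinuous f -> ccontinuous g ->
  has_cmean f z1 -> has_cmean g z2 -> has_cmean (fun x => f x + g x) (z1 + z2).
Proof.
move=> [f1 f2] [g1 g2] [m1 m2] [n1 n2]; split.
  by under eq_fun do rewrite ReD; rewrite ReD; exact: has_meanD.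
by under eq_fun do rewrite ImD; rewrite ImD; exact: has_meanD.
Qed.

Lemma has_cmeanZ z f z1 : ccontinuous f ->
  has_cmean f z1 -> has_cmean (fun x => z * f x) (z * z1).
Proof.
move=> [f1 f2] [m1 m2].
have cZ (c : R) (g : R -> R) : continuous g -> continuous (fun x => c * g x).
  by move=> cg x; apply: cvgMr; exact: cg.
split.
  rewrite ReM -mulNr; under eq_fun do rewrite ReM -mulNr.
  by apply: has_meanD; [exact: cZ|exact: cZ|exact: has_meanZ|exact: has_meanZ].
rewrite ImM; under eq_fun do rewrite ImM.
by apply: has_meanD; [exact: cZ|exact: cZ|exact: has_meanZ|exact: has_meanZ].
Qed.

Lemma has_cmean_sum (I : Type) (r : seq I) (F : I -> R -> R[i]) (Z : I -> R[i]) :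
  (forall i, ccontinuous (F i)) -> (forall i, has_cmean (F i) (Z i)) ->
  has_cmean (fun x => \sum_(i <- r) F i x) (\sum_(i <- r) Z i).
Proof.
move=> cF mF; elim: r => [|i r IH].
  rewrite big_nil; under eq_fun do rewrite big_nil.
  by split; exact: has_mean_cst.
rewrite big_cons; under eq_fun do rewrite big_cons.
by apply: has_cmeanD => //; exact: ccontinuous_sum.
Qed.

Lemma has_cmean_chi w : has_cmean (chi w) (w == 0)%:R.
Proof.
split; rewrite /chi/=; first by have := @has_mean_cos R w; case: (w == 0).
by have := @has_mean_sin R w; case: (w == 0).
Qed.

Lemma has_cmean_expsum s (a : R -> R[i]) :
  has_cmean (expsum s a) (\sum_(w <- s) a w * (w == 0)%:R).
Proof.
apply: has_cmean_sum => w.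
  by apply: ccontinuousM; [exact: ccontinuous_cst|exact: ccontinuous_chi].
by apply: has_cmeanZ; [exact: ccontinuous_chi|exact: has_cmean_chi].
Qed.

Lemma mean_has_cmean f z : has_cmean f z -> mean f = z.
Proof.
move=> [mR mI]; rewrite /mean.
apply: (@cvg_lim (R[i]^o) (@norm_hausdorff _ (R[i]^o))).

(* The radius is a positive element of [R[i]], that is, real and positive. *)
apply/(@cvgrPdist_le _ (R[i]^o)) => -[e e'] /=; rewrite ltcE/= => /andP[/eqP -> e0].
have e2 : 0 < e / 2 by rewrite divr_gt0.
near=> L.
have hR : `|complex.Re z - average (fun x => complex.Re (f x)) L| <= e / 2.
  by near: L; move/cvgrPdist_le : mR; exact.
have hI : `|complex.Im z - average (fun x => complex.Im (f x)) L| <= e / 2.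
  by near: L; move/cvgrPdist_le : mI; exact.
rewrite -[_ +i* 0]/(e%:C) -[ `|_|]/((cabs _)%:C) lecR.
apply: le_trans (ler_cabs_ReIm _) _.
rewrite ReB ImB ReM ImM /= !mul0r subr0 addr0.
by move: hR hI; rewrite /average; lra.
Unshelve. all: by end_near.
Qed.

End complex_mean.

Section almost_periodic.
Context {R : realType}.
Implicit Types (f : R -> R[i]) (w x : R).

Lemma continuous_ccontinuous f : continuous f -> ccontinuous f.
Proof.
move=> cf.
have h (p : R[i] -> R) x : (forall z1 z2, `|p z1 - p z2| <= cabs (z1 - z2)) ->
    p (f y) @[y --> x] --> p (f x).
  move=> pP; apply/cvgrPdist_le => e e0.
  have := cf x; move=> /(@cvgrPdist_le _ (R[i]^o)) /(_ e%:C); rewrite ltcR => /(_ e0).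
  apply: filterS => y; rewrite -[ `|_|]/((cabs _)%:C) lecR.
  exact: le_trans.
split=> x; apply: (h _ x) => z1 z2.
  by rewrite -ReB ler_Re_cabs.
by rewrite -ImB ler_Im_cabs.
Qed.

Lemma expsum_mul_chiN s (a : R -> R[i]) w x :
  expsum s a x * chi (- w) x = expsum [seq v - w | v <- s] (fun v => a (v + w)) x.
Proof. by rewrite expsum_shift mulrC. Qed.

(** [fourier] is a [lim] and could be a default value; approximation by trigonometric polynomials
    shows that the mean exists. *)
Lemma fourierP f w : uniformly_almost_periodic f ->
  has_cmean (fun x => f x * chi (- w) x) (fourier f w).
Proof.
move=> [/continuous_ccontinuous cf _ fa].
have cF : ccontinuous (fun x => f x * chi (- w) x).
  by apply: ccontinuousM => //; exact: ccontinuous_chi.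
have app e : 0 < e -> exists g z, [/\ ccontinuous g, has_cmean g z &
    forall x, cabs (f x * chi (- w) x - g x) <= e].
  move=> /fa[a fae]; exists (expsum [seq v - w | v <- finsupp a] (fun v => a (v + w))).
  exists (\sum_(v <- [seq v - w | v <- finsupp a]) a (v + w) * (v == 0)%:R).
  split; [exact: ccontinuous_expsum|exact: has_cmean_expsum|] => x.
  rewrite -expsum_mul_chiN -mulrBl cabsM cabs_chi mulr1; exact: fae.
have [mR hR] : exists m, has_mean (fun x => complex.Re (f x * chi (- w) x)) m.
  apply: has_mean_approx; first exact: cF.1.
  move=> e /app[g [z [cg hg gP]]]; exists (fun x => complex.Re (g x)), (complex.Re z).
  by split; [exact: cg.1|exact: hg.1|] => x; rewrite -ReB (le_trans (ler_Re_cabs _)).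
have [mI hI] : exists m, has_mean (fun x => complex.Im (f x * chi (- w) x)) m.
  apply: has_mean_approx; first exact: cF.2.
  move=> e /app[g [z [cg hg gP]]]; exists (fun x => complex.Im (g x)), (complex.Im z).
  by split; [exact: cg.2|exact: hg.2|] => x; rewrite -ImB (le_trans (ler_Im_cabs _)).
have h : has_cmean (fun x => f x * chi (- w) x) (mR +i* mI) by split.
suff -> : fourier f w = mR +i* mI by [].
rewrite -(mean_has_cmean h) /fourier; congr mean; apply/funext => x.
by congr (_ * _); rewrite chiN.
Qed.

End almost_periodic.

(** * Bochner-Fejér summation *)

Section folner.
Context {R : realType}.
Implicit Types (F : seq R) (v w x : R) (N : nat).

(** Sums of k_w w with integers 0 <= k_w <= N, one for each entry w of F. Integer relations between
    the frequencies cause repetitions, removed later by [undup]. *)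
Fixpoint folner_box F N : seq R :=
  if F is w :: F' then [seq v + w *+ k | v <- folner_box F' N, k <- iota 0 N.+1]
  else [:: 0].

Lemma size_folner_box F N : size (folner_box F N) = (N.+1 ^ size F)%N.
Proof.
elim: F => // w F IH.
transitivity (size [seq v + w *+ k | v <- folner_box F N, k <- iota 0 N.+1]) => //.
by rewrite size_allpairs IH size_iota expnSr.
Qed.

Lemma folner_boxP w F N x : reflect
  (exists p : R * nat, [/\ p.1 \in folner_box F N, (p.2 < N.+1)%N & x = p.1 + w *+ p.2])
  (x \in folner_box (w :: F) N).
Proof.
apply: (iffP allpairsP) => -[p [p1 p2 ->]]; exists p; split=> //.
  by move: p2; rewrite mem_iota.
by rewrite mem_iota.
Qed.

Lemma folner_box_sub F N : {subset folner_box F N <= folner_box F N.+1}.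
Proof.
elim: F => // w F IH _ /folner_boxP[[v k] [vF kN ->]].
by apply/folner_boxP; exists (v, k); split=> //; [exact: IH|exact: leqW].
Qed.

Lemma folner_box_add F N v w :
  v \in folner_box F N -> w \in F -> v + w \in folner_box F N.+1.
Proof.
elim: F v => // u F IH _ /folner_boxP[[v k] [vF kN ->]].
rewrite inE => /predU1P[->|wF]; apply/folner_boxP.
  exists (v, k.+1); split=> //; first exact: folner_box_sub.
  by rewrite -addrA -mulrSr.
exists (v + w, k); split; [exact: IH|exact: leqW|].
by rewrite addrAC.
Qed.

Lemma bernoulli (e : R) N : 0 <= e -> 1 + e *+ N <= (1 + e) ^+ N.
Proof.
move=> e0; elim: N => [|N IH]; first by rewrite mulr0n addr0 expr0.
have eN : 0 <= e *+ N by rewrite mulrn_wge0.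
rewrite exprS mulrS (le_trans _ (ler_wpM2l _ IH))//; last by lra.
by nra.
Qed.

(** For N = M (m + 1), Bernoulli's inequality gives (1 + e)^N >= (e M)^(m+1), while (N + 1)^m <= (M
    (m + 2))^m; a large M decides. *)
Lemma exp_gt_poly (e : R) m : 0 < e -> exists N, N.+1%:R ^+ m < (1 + e) ^+ N.
Proof.
move=> e0; pose M := (Num.truncn ((m + 2)%:R ^+ m / e ^+ m.+1)).+1.
have em : 0 < e ^+ m.+1 by rewrite exprn_gt0.
have : (m + 2)%:R ^+ m / e ^+ m.+1 < M%:R.
  have h : 0 <= (m + 2)%:R ^+ m / e ^+ m.+1 by rewrite divr_ge0 ?exprn_ge0// ltW.
  by have /andP[] := truncn_itv h.
rewrite ltr_pdivrMr// => MP.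
have M0 : 0 < M%:R :> R by rewrite ltr0n.
exists (M * m.+1)%N; rewrite exprM.
have eM : e *+ M <= (1 + e) ^+ M.
  by apply: le_trans (bernoulli M (ltW e0)); rewrite lerDr.
have eM0 : 0 <= e *+ M by rewrite mulrn_wge0// ltW.
apply: lt_le_trans (lerXn2r _ eM0 (le_trans eM0 eM) eM).
have : (M * m.+1).+1%:R ^+ m <= (M%:R * (m + 2)%:R) ^+ m :> R.
  by apply: lerXn2r; rewrite ?nnegrE ?mulr_ge0// -natrM ler_nat; rewrite /M; lia.
move=> /le_lt_trans; apply; rewrite exprMn -[e *+ M]mulr_natl exprMn [M%:R ^+ m.+1]exprSr -mulrA.
by rewrite ltr_pM2l ?exprn_gt0.
Qed.

(* The boxes grow polynomially, so |A_(N+1)| <= (1 + e) |A_N| for some N; this avoids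
   choosing a basis of the frequencies over the rationals. *)
Lemma exists_folner F (e : R) : 0 < e -> exists A : seq R,
  [/\ uniq A, (0 < size A)%N & forall w, w \in F ->
    (1 - e) * (size A)%:R <= (count (fun v => v + w \in A) A)%:R].
Proof.
move=> e0; pose A N := undup (folner_box F N).
have A0 N : (0 < size (A N))%N.
  rewrite lt0n size_eq0 /A; apply/eqP => /undup_nil/eqP.
  by rewrite -size_eq0 size_folner_box expn_eq0.
have [N AN] : exists N, (size (A N.+1))%:R <= (1 + e) * (size (A N))%:R.
  (* Otherwise |A N| would be at least (1 + e)^N, although it is at most (N + 1)^|F|. *)
  apply: contrapT => /forallNP h; have [N] := exp_gt_poly (size F) e0.
  apply/negP; rewrite -leNgt.
  suff /le_trans : (1 + e) ^+ N <= (size (A N))%:R.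
    by apply; rewrite -natrX ler_nat -(size_folner_box F N) size_undup.
  elim: N => [|N IH]; first by rewrite expr0 ler1n.
  have /negP := h N; rewrite -ltNge => /ltW; apply: le_trans.
  by rewrite exprS ler_wpM2l//; lra.
exists (A N); split=> [||w wF]; [exact: undup_uniq|exact: A0|].
set c := count _ _.
(* A N and the translates v + w that leave it are disjoint parts of A (N + 1). *)
have : (size (A N) + (size (A N) - c) <= size (A N.+1))%N.
  have -> : (size (A N) - c)%N = size [seq v <- map (+%R^~ w) (A N) | v \notin A N].
    rewrite size_filter count_map -(count_predC (fun v => v + w \in A N) (A N)).
    by rewrite addnC addnK.
  rewrite -size_cat; apply: uniq_leq_size.
    rewrite cat_uniq undup_uniq filter_uniq ?andbT/=; last first.
      by rewrite map_inj_uniq ?undup_uniq//; exact: addIr.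
    by rewrite -all_predC; apply/allP => v; rewrite mem_filter => /andP[].
  move=> v; rewrite mem_cat mem_undup => /orP[]; rewrite mem_undup.
    exact: folner_box_sub.
  rewrite mem_filter => /andP[_ /mapP[u]]; rewrite mem_undup => uF ->.
  exact: folner_box_add.
rewrite -(ler_nat R) natrD natrB ?count_size//.
by move=> h; lra.
Qed.

End folner.

Section bochner_fejer.
Context {R : realType}.
Implicit Types (f g : R -> R[i]) (h a : R -> R[i]) (A s : seq R) (x t w : R).

(** The Fejér kernel of a frequency set. For A nonempty without repetitions it has mean 1, and its
    coefficient at w is the proportion of v in A with v + w in A. *)
Definition fejer A x : R := (size A)%:R^-1 * cabs (expsum A (fun=> 1) x) ^+ 2.

Lemma fejer_ge0 A x : 0 <= fejer A x.
Proof. by rewrite mulr_ge0 ?invr_ge0 ?sqr_ge0. Qed.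

Lemma fejerE A x t : (fejer A (x - t))%:C =
  ((size A)%:R^-1)%:C * \sum_(v <- A) \sum_(v' <- A) chi (v - v') x * chi (- (v - v')) t.
Proof.
rewrite /fejer rmorphM/=; congr (_ * _).
have -> (z : R[i]) : (cabs z ^+ 2)%:C = z * z^*.
  rewrite cabsE sqr_sqrtr ?addr_ge0 ?sqr_ge0//.
  by case: z => u v /=; apply: complex_eqP => /=; ring.
rewrite (_ : Num.conj (expsum A _ _) = \sum_(v <- A) chi (- v) (x - t)); last first.
  by rewrite /expsum rmorph_sum; apply: eq_bigr => v _; rewrite mul1r chiN.
rewrite /expsum mulr_suml; apply: eq_bigr => v _.
rewrite mulr_sumr; apply: eq_bigr => v' _.
rewrite mul1r -chiD chiDr; congr (_ * _).
by rewrite /chi mulrN mulNr.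
Qed.

(** The convolution with the kernel, written on the Fourier side: h stands for the Fourier transform
    of the function smoothed. *)
Definition fejer_sum A h x : R[i] :=
  ((size A)%:R^-1)%:C * \sum_(v <- A) \sum_(v' <- A) h (v - v') * chi (v - v') x.

Lemma ccontinuous_fejer A x : ccontinuous (fun t => (fejer A (x - t))%:C).
Proof.
under eq_fun do rewrite fejerE.
apply: ccontinuousM; first exact: ccontinuous_cst.
do 2!(apply: ccontinuous_sum => ?).
by apply: ccontinuousM; [exact: ccontinuous_cst|exact: ccontinuous_chi].
Qed.

Lemma has_mean_norm_le (g k : R -> R) (m m' : R) : continuous g -> continuous k ->
  (forall t, `|g t| <= k t) -> has_mean g m -> has_mean k m' -> `|m| <= m'.
Proof.
move=> cg ck gk hg hk; rewrite ler_norml lerNl; apply/andP; split.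
  have cNg : continuous (fun t => -1 * g t) by move=> t; apply: cvgMr; exact: cg.
  rewrite -mulN1r; apply: (has_mean_le cNg ck _ (has_meanZ cg hg) hk) => t.
  by have := gk t; rewrite ler_norml; lra.
by apply: (has_mean_le cg ck _ hg hk) => t; rewrite (le_trans (ler_norm _)).
Qed.

Lemma has_cmean_fejer A g h x : ccontinuous g ->
  (forall w, has_cmean (fun t => g t * chi (- w) t) (h w)) ->
  has_cmean (fun t => g t * (fejer A (x - t))%:C) (fejer_sum A h x).
Proof.
move=> cg gh.
have -> : (fun t => g t * (fejer A (x - t))%:C) = (fun t => ((size A)%:R^-1)%:C *
    \sum_(v <- A) \sum_(v' <- A) chi (v - v') x * (g t * chi (- (v - v')) t)).
  apply/funext => t; rewrite fejerE mulrCA; congr (_ * _).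
  rewrite mulr_sumr; apply: eq_bigr => v _; rewrite mulr_sumr; apply: eq_bigr => v' _.
  by rewrite mulrCA.
have c1 w : ccontinuous (fun t => g t * chi (- w) t).
  by apply: ccontinuousM => //; exact: ccontinuous_chi.
have c2 w : ccontinuous (fun t => chi w x * (g t * chi (- w) t)).
  by apply: ccontinuousM => //; exact: ccontinuous_cst.
apply: has_cmeanZ; first by do 2!(apply: ccontinuous_sum => ?).
apply: has_cmean_sum => v; first by apply: ccontinuous_sum.
apply: has_cmean_sum => v'; first by [].
by rewrite [h _ * _]mulrC; apply: has_cmeanZ.
Qed.

(** Pairs (v, v') in A with difference w correspond to the v' in A with v' + w in A. *)
Lemma fejer_sum_delta A w x : uniq A ->
  \sum_(v <- A) \sum_(v' <- A) (w == v - v')%:R * chi (v - v') x =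
  (count (fun v => v + w \in A) A)%:R * chi w x.
Proof.
move=> uA; rewrite exchange_big/= -sum1_count natr_sum mulr_suml [RHS]big_mkcond.
apply: eq_bigr => v' _.
transitivity (\sum_(v <- A | v == v' + w) chi w x).
  rewrite [RHS]big_mkcond; apply: eq_bigr => v _.
  have [->|vw] := eqVneq v (v' + w); first by rewrite addrC addKr eqxx mul1r.
  rewrite (_ : _ == _ = false) ?mul0r//; apply/negbTE.
  by apply: contra vw => /eqP ->; rewrite addrC subrK.
rewrite big_const_seq -/(count_mem _ _) count_uniq_mem//.
by case: (_ \in _) => //=; rewrite addr0 mul1r.
Qed.

(** Convolving f with the kernel creates no frequency outside the spectrum. On a polynomial p close
    to f it is nearly the identity by the Følner property, and it keeps the small function f - p
    small. *)
Lemma bochner_fejer f (e : R) : uniformly_almost_periodic f -> 0 < e ->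
  exists s a, (forall w, w \in s -> spectrum f w) /\
    forall x, cabs (f x - expsum s a x) <= e.
Proof.
move=> fU e0; have [cf _ fa] := fU.
have e4 : 0 < e / 4 by rewrite divr_gt0.
have [a fae] := fa _ e4.
pose S := \sum_(w <- finsupp a) cabs (a w).
have S0 : 0 <= S by apply: sumr_ge0 => w _; exact: cabs_ge0.
pose d := e / 4 / (S + 1).
have d0 : 0 < d by rewrite divr_gt0// ltr_wpDl.
have Sd : S * d <= e / 4.
  rewrite mulrCA ler_piMr ?(ltW e4)// ler_pdivrMr ?ltr_wpDl// mul1r lerDl//.
have [A [uA A0 AF]] := exists_folner (finsupp a) d0.
pose n : R := (size A)%:R; have n0 : 0 < n by rewrite ltr0n.
(* Differences are listed with repetition; the multiplicity of w supplies its Fejér weight. *)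
pose s0 := [seq v - v' | v <- A, v' <- A].
exists [seq w <- s0 | fourier f w != 0], (fun w => (n^-1)%:C * fourier f w); split.
  by move=> w; rewrite mem_filter => /andP[].
move=> x.
have -> : expsum [seq w <- s0 | fourier f w != 0] (fun w => (n^-1)%:C * fourier f w) x =
    fejer_sum A (fourier f) x.
  rewrite /expsum big_filter big_mkcond/= big_allpairs_dep /fejer_sum mulr_sumr.
  apply: eq_bigr => v _; rewrite mulr_sumr; apply: eq_bigr => v' _.
  by case: eqP => [->|_] /=; rewrite ?mul0r ?mulr0// mulrA.
pose p := expsum (finsupp a) a.
pose ph u := \sum_(w <- finsupp a) a w * (w == u)%:R.
have cp : ccontinuous p by exact: ccontinuous_expsum.
have pP w : has_cmean (fun t => p t * chi (- w) t) (ph w).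
  rewrite (_ : (fun t => _) = expsum [seq v - w | v <- finsupp a] (fun v => a (v + w))).
    have := has_cmean_expsum [seq v - w | v <- finsupp a] (fun v => a (v + w)).
    rewrite big_map (eq_bigr (fun v => a v * (v == w)%:R))// => v _.
    by rewrite subrK subr_eq0.
  by apply/funext => t; rewrite expsum_mul_chiN.
have fejer_ph : fejer_sum A ph x =
    \sum_(w <- finsupp a) a w * ((count (fun v => v + w \in A) A)%:R / n)%:C * chi w x.
  rewrite /fejer_sum /ph.
  transitivity (\sum_(w <- finsupp a) a w * ((n^-1)%:C *
      \sum_(v <- A) \sum_(v' <- A) (w == v - v')%:R * chi (v - v') x)).
    under [in RHS]eq_bigr => w _ do rewrite mulrCA mulr_sumr.
    rewrite -mulr_sumr; congr (_ * _); rewrite [RHS]exchange_big/=.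
    apply: eq_bigr => v _.
    under [in RHS]eq_bigr => w _ do rewrite mulr_sumr.
    rewrite exchange_big/=; apply: eq_bigr => v' _.
    by rewrite mulr_suml; apply: eq_bigr => w _; rewrite mulrA.
  apply: eq_bigr => w _; rewrite fejer_sum_delta// -[RHS]mulrA; congr (_ * _).
  by rewrite mulrA mulrC [in RHS]mulrC; congr (_ * _); rewrite rmorphM/= rmorph_nat mulrC.
have B1 : cabs (f x - p x) <= e / 4 by exact: fae.
have B2 : cabs (p x - fejer_sum A ph x) <= e / 4.
  rewrite fejer_ph /p /expsum -sumrB (le_trans (cabs_sum _ _))// (le_trans _ Sd)//.
  rewrite /S mulr_suml big_seq [leRHS]big_seq; apply: ler_sum => w wa.
  rewrite -mulrBl cabsM cabs_chi mulr1 -{1}[a w]mulr1 -mulrBr cabsM ler_wpM2l ?cabs_ge0//.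
  have -> (r : R) : cabs (1 - r%:C) = `|1 - r|.
    by rewrite -cabsR; congr cabs; apply: complex_eqP => //=; rewrite subrr.
  have := AF w wa; have := count_size (fun v => v + w \in A) A.
  rewrite -(ler_nat R) -/n; set c : R := (count _ _)%:R => cn nc.
  have c1 : c / n <= 1 by rewrite ler_pdivrMr// mul1r.
  have c2 : 1 - d <= c / n by rewrite ler_pdivlMr.
  by rewrite ger0_norm; lra.
(* A nonnegative kernel of mean 1 leaves the real and the imaginary part of the smoothed p - f at
   most e/4 each. *)
have B3 : cabs (fejer_sum A ph x - fejer_sum A (fourier f) x) <= e / 2.
  have cone : ccontinuous (fun=> 1 : R[i]) by exact: ccontinuous_cst.
  have oneP w : has_cmean (fun t : R => 1 * chi (- w) t) (0 == w)%:R.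
    rewrite (_ : (fun t => _) = chi (- w)); last by apply/funext => t; rewrite mul1r.
    by have := has_cmean_chi (- w); rewrite oppr_eq0 eq_sym.
  have fone : fejer_sum A (fun w => (0 == w)%:R) x = 1.
    rewrite /fejer_sum fejer_sum_delta// chi0 mulr1.
    under eq_count do rewrite addr0.
    rewrite (_ : count _ _ = size A); last by apply/eqP; rewrite -all_count; exact/allP.
    rewrite -[_%:R in X in _ * X](rmorph_nat (real_complex R)) -rmorphM/= mulVf//.
    exact: lt0r_neq0.
  have [m1 _] := has_cmean_fejer A x cone oneP; rewrite fone in m1.
  have cK : ccontinuous (fun t => (fejer A (x - t))%:C) by exact: ccontinuous_fejer.
  have m1' : has_mean (fun t => fejer A (x - t)) 1.
    by move: m1; under eq_fun do rewrite mul1r.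
  have cf' := continuous_ccontinuous cf.
  have cmf : ccontinuous (fun t => -1 * f t) by apply: ccontinuousM => //; exact: ccontinuous_cst.
  have cg : ccontinuous (fun t => p t + -1 * f t) by exact: ccontinuousD.
  have gP w : has_cmean (fun t => (p t + -1 * f t) * chi (- w) t) (ph w + -1 * fourier f w).
    rewrite (_ : (fun t => _) = fun t => p t * chi (- w) t + -1 * (f t * chi (- w) t)).
      have cc := ccontinuous_chi (- w).
      apply: has_cmeanD; [exact: ccontinuousM| |exact: pP|].
        by apply: ccontinuousM; [exact: ccontinuous_cst|exact: ccontinuousM].
      by apply: has_cmeanZ; [exact: ccontinuousM|exact: fourierP].
    by apply/funext => t; rewrite mulrDl mulrA.
  have := has_cmean_fejer A x cg gP.
  rewrite (_ : fejer_sum A _ x = fejer_sum A ph x - fejer_sum A (fourier f) x); last first.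
    rewrite /fejer_sum -mulrBr -sumrB; congr (_ * _); apply: eq_bigr => v _.
    by rewrite -sumrB; apply: eq_bigr => v' _; rewrite mulN1r mulrBl.
  move=> [mR mI].
  have gK t : cabs ((p t + -1 * f t) * (fejer A (x - t))%:C) <= e / 4 * fejer A (x - t).
    rewrite cabsM cabsR (ger0_norm (fejer_ge0 _ _)) ler_wpM2r ?fejer_ge0//.
    by rewrite mulN1r -cabsN opprB; exact: fae.
  have cK4 : continuous (fun t => e / 4 * fejer A (x - t)).
    by move=> t; apply: cvgMr; exact: cK.1.
  have mK4 := has_meanZ (c := e / 4) cK.1 m1'; rewrite mulr1 in mK4.
  have [cgR cgI] := ccontinuousM cg cK.
  have hR := has_mean_norm_le cgR cK4 (fun t => le_trans (ler_Re_cabs _) (gK t)) mR mK4.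
  have hI := has_mean_norm_le cgI cK4 (fun t => le_trans (ler_Im_cabs _) (gK t)) mI mK4.
  by apply: le_trans (ler_cabs_ReIm _) _; lra.
have -> : f x - fejer_sum A (fourier f) x = (f x - p x) + ((p x - fejer_sum A ph x) +
    (fejer_sum A ph x - fejer_sum A (fourier f) x)) by ring.
rewrite (le_trans (cabsD _ _))//; have := cabsD (p x - fejer_sum A ph x) (fejer_sum A ph x - fejer_sum A (fourier f) x).
by move: B1 B2 B3; lra.
Qed.

End bochner_fejer.

(** * Almost periodic functions with bounded spectrum *)

Section lower_bound.
Context {R : realType}.
Implicit Types (s : seq R) (A B : R -> R) (f : R -> R[i]) (x y l w : R).

(* Mean value theorem for a primitive, which is the mean times x plus a bounded
   function. *)
Lemma trigsum_window s A B : exists2 K, 0 <= K & forall x l, 0 < l ->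
  exists y, x <= y <= x + l /\
    `|\sum_(v <- s) A v * (v == 0)%:R| - K / l <= `|trigsum s A B y|.
Proof.
set m := \sum_(v <- s) _; pose s' := [seq v <- s | v != 0].
pose r := trigsum s' (fun v => - (B v / v)) (fun v => A v / v).
pose K1 := \sum_(v <- s') (`|B v / v| + `|A v / v|).
have rK x : `|r x| <= K1.
  apply: le_trans (ler_norm_sum _ _ _) _; apply: ler_sum => v _.
  apply: le_trans (ler_normD _ _) _; rewrite !normrM normrN -!normrM lerD//.
    by rewrite normrM ler_piMr// cos_max.
  by rewrite normrM ler_piMr// sin_max.
have K10 : 0 <= K1 := le_trans (normr_ge0 _) (rK 0).
exists (2 * K1); first by rewrite mulr_ge0.
move=> x l l0.
have GP (t : R) : is_derive t 1 (fun t => m * t + r t) (trigsum s A B t).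
  have ? : is_derive t 1 r _ := is_derive_trigsum _ _ _ _.
  apply: is_derive_eq; rewrite /GRing.scale/= mulr1 /m /trigsum big_filter.
  rewrite [X in _ + X]big_mkcond -big_split; apply: eq_bigr => v _ /=.
  have [->|v0] := eqVneq v 0.
    by rewrite /= !mul0r cos0 sin0; ring.
  by rewrite /= mulr0 add0r; field.
have xl : x <= x + l by rewrite lerDl ltW.
have [|y] := MVT_segment xl (fun t _ => GP t).
  apply: continuous_subspaceT => t; apply/differentiable_continuous/derivable1_diffP.
  exact: (@ex_derive _ _ _ _ _ _ _ (GP t)).
rewrite in_itv/= => yx yE; exists y; split=> //.
rewrite -(ler_pM2r l0) mulrBl mulfVK ?gt_eqF// -[l in leLHS]gtr0_norm//.
rewrite -[l in leRHS]gtr0_norm// -!normrM lerBlDr.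
have -> : m * l = trigsum s A B y * l + (r x - r (x + l)).
  have -> : trigsum s A B y * l = trigsum s A B y * (x + l - x) by ring.
  by rewrite -yE; ring.
apply: le_trans (ler_normD _ _) _; rewrite lerD2l.
apply: le_trans (ler_normB _ _) _.
by have := rK x; have := rK (x + l); lra.
Qed.

Lemma has_cmean_norm_le (g : R -> R[i]) (z : R[i]) (k : R) : ccontinuous g ->
  (forall t, cabs (g t) <= k) -> has_cmean g z ->
  `|complex.Re z| <= k /\ `|complex.Im z| <= k.
Proof.
move=> [g1 g2] gk [m1 m2].
have ck : continuous (fun _ : R => k) by move=> ?; exact: cvg_cst.
split.
  exact: (has_mean_norm_le g1 ck (fun t => le_trans (ler_Re_cabs _) (gk t)) m1 (@has_mean_cst R k)).
exact: (has_mean_norm_le g2 ck (fun t => le_trans (ler_Im_cabs _) (gk t)) m2 (@has_mean_cst R k)).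
Qed.

(** Modulating an approximant by -w turns its coefficient at w into a constant term z close to the
    Fourier coefficient; [trigsum_window] then finds large values in every long window. *)
Lemma almost_periodic_window f w : uniformly_almost_periodic f -> spectrum f w ->
  exists l d, [/\ 0 < l, 0 < d &
    forall x, exists y, x <= y <= x + l /\ d <= cabs (f y)].
Proof.
move=> fU; rewrite /spectrum/= -cabs_eq0 => fw.
have := fU => -[/continuous_ccontinuous cf _ fa].
pose c := cabs (fourier f w).
have c0 : 0 < c by rewrite lt_neqAle eq_sym fw cabs_ge0.
(* With error c/8, one of |Re z|, |Im z| is at least c/4; the window costs c/16 and the
   approximation c/8, which leaves c/16. *)
have [|a fae] := fa (c / 8); first by rewrite divr_gt0.
pose s := [seq v - w | v <- finsupp a]; pose b v := a (v + w).
have qE t : expsum s b t = trigpoly_fun a t * chi (- w) t by rewrite -expsum_mul_chiN.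
pose z := \sum_(v <- s) b v * (v == 0)%:R.
have [hR hI] : `|complex.Re (z + -1 * fourier f w)| <= c / 8 /\
    `|complex.Im (z + -1 * fourier f w)| <= c / 8.
  have cF : ccontinuous (fun t => f t * chi (- w) t).
    by apply: ccontinuousM => //; exact: ccontinuous_chi.
  have cq : ccontinuous (expsum s b) by exact: ccontinuous_expsum.
  have cNF : ccontinuous (fun t => -1 * (f t * chi (- w) t)).
    by apply: ccontinuousM => //; exact: ccontinuous_cst.
  apply: (@has_cmean_norm_le (fun t => expsum s b t + -1 * (f t * chi (- w) t))).
  - exact: ccontinuousD.
  - move=> t; rewrite qE mulN1r -mulrBl cabsM cabs_chi mulr1 -cabsN opprB; exact: fae.
  - apply: has_cmeanD => //; first exact: has_cmean_expsum.
    by apply: has_cmeanZ => //; exact: fourierP.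
have zc : c / 2 <= `|complex.Re z| + `|complex.Im z|.
  have := ler_cabs_ReIm (fourier f w); rewrite -/c.
  move: hR hI; rewrite mulN1r ReB ImB.
  have := ler_normB (complex.Re z) (complex.Re z - complex.Re (fourier f w)).
  have := ler_normB (complex.Im z) (complex.Im z - complex.Im (fourier f w)).
  by rewrite !subKr; lra.
have [K1 K10 K1P] := trigsum_window s (fun v => complex.Re (b v)) (fun v => - complex.Im (b v)).
have [K2 K20 K2P] := trigsum_window s (fun v => complex.Im (b v)) (fun v => complex.Re (b v)).
have zR : complex.Re z = \sum_(v <- s) complex.Re (b v) * (v == 0)%:R.
  rewrite /z Re_sum; apply: eq_bigr => v _; rewrite ReM.
  by case: (v == 0) => /=; rewrite ?mulr1 ?mulr0 ?subr0.
have zI : complex.Im z = \sum_(v <- s) complex.Im (b v) * (v == 0)%:R.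
  rewrite /z Im_sum; apply: eq_bigr => v _; rewrite ImM.
  by case: (v == 0) => /=; rewrite ?mulr1 ?mulr0 ?add0r.
pose l := 16 * (K1 + K2 + 1) / c.
have l0 : 0 < l by rewrite divr_gt0// mulr_gt0//; lra.
have Kl K : 0 <= K -> K <= K1 + K2 -> K / l <= c / 16.
  move=> K0 KK; rewrite ler_pdivrMr//.
  have -> : c / 16 * l = K1 + K2 + 1 by rewrite /l; field; exact: lt0r_neq0.
  by lra.
exists l, (c / 16); split=> //; first by rewrite divr_gt0.
move=> x.
have fin y : `|complex.Re (expsum s b y)| >= 3 * c / 16 \/
    `|complex.Im (expsum s b y)| >= 3 * c / 16 -> c / 16 <= cabs (f y).
  move=> h; have : 3 * c / 16 <= cabs (expsum s b y).
    by case: h => /le_trans; apply; [exact: ler_Re_cabs|exact: ler_Im_cabs].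
  rewrite qE cabsM cabs_chi mulr1 => {}h.
  have := fae y; have := cabsD (f y) (- (f y - trigpoly_fun a y)).
  by rewrite subKr cabsN; lra.
have [zR4|zI4] := leP (c / 4) `|complex.Re z|.
  have [y [xy yP]] := K1P x l l0; exists y; split=> //; apply: fin; left.
  rewrite Re_expsum; apply: le_trans yP; rewrite -zR.
  by have := Kl K1 K10; rewrite lerDl => /(_ K20); lra.
have [y [xy yP]] := K2P x l l0; exists y; split=> //; apply: fin; right.
rewrite Im_expsum; apply: le_trans yP; rewrite -zI.
by have := Kl K2 K20; rewrite lerDr => /(_ K10); lra.
Qed.

(* The majorants e exp t + E t^n / n! are successive primitives of each other. *)
Lemma taylor_majorant n (g : nat -> R -> R) x (T e E : R) : derivative_chain g ->
  0 <= e -> (forall k, (k < n)%N -> `|g k x| <= e) ->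
  (forall t, 0 <= t <= T -> `|g n (x + t)| <= E) ->
  forall t, 0 <= t <= T -> `|g 0%N (x + t)| <= e * expR t + E * (t ^+ n / n`!%:R).
Proof.
move=> + e0; elim: n g => [|n IH] g gP gk gE t tT.
  rewrite expr0 divr1 mulr1 (le_trans (gE t tT))// lerDr mulr_ge0// ltW// expR_gt0.
have {}IH := IH (fun k => g k.+1) (fun k => gP k.+1) (fun k => gk k.+1) gE.
pose P t := e * expR t + E * (t ^+ n.+1 / n.+1`!%:R).
have dP (u : R) : is_derive u 1 P (e * expR u + E * (u ^+ n / n`!%:R)).
  have ? : is_derive u 1 (fun u : R => u ^+ n.+1) (n.+1%:R * u ^+ n).
    have := is_deriveX n.+1 (is_derive_id u (1 : R)).
    rewrite (_ : id ^+ n.+1 = fun u => u ^+ n.+1); last first.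
      by apply/funext => v; rewrite exprfctE.
    by rewrite /GRing.scale /= mulr1.
  rewrite (_ : P = fun u => e * expR u + (E / n.+1`!%:R) * (u ^+ n.+1)); last first.
    by apply/funext => v; rewrite /P mulrAC -mulrA.
  apply: is_derive_eq; rewrite /GRing.scale; congr (_ + _).
  transitivity (E / n.+1`!%:R * (n.+1%:R * u ^+ n)); first by [].
  rewrite factS natrM; field.
  by rewrite nat1r !pnatr_eq0 -lt0n fact_gt0.
have gxP (u : R) : is_derive u 1 (fun u => g 0%N (x + u)) (g 1%N (x + u)).
  have ? := gP 0%N (x + u).
  have ? : is_derive u 1 (fun u : R => x + u) 1.
    by have := is_deriveD (is_derive_cst x u (1 : R)) (is_derive_id u (1 : R)); rewrite add0r.
  have := @is_derive1_comp R (g 0%N) (fun u => x + u) u (g 1%N (x + u)) 1 _ _.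
  by rewrite mulr1 => h; exact: h.
have P0 : P 0 = e by rewrite /P expR0 expr0n /= mul0r mulr0 addr0 mulr1.
have := gk 0%N isT; rewrite !ler_norml => /andP[gx1 gx2].
move: tT => /andP[t0 tT].
have d1 (u : R) : is_derive u 1 (fun u => P u + g 0%N (x + u))
    (e * expR u + E * (u ^+ n / n`!%:R) + g 1%N (x + u)).
  by have ? := dP u; have ? := gxP u; exact: is_deriveD.
have d2 (u : R) : is_derive u 1 (fun u => P u - g 0%N (x + u))
    (e * expR u + E * (u ^+ n / n`!%:R) - g 1%N (x + u)).
  by have ? := dP u; have ? := gxP u; exact: is_deriveB.
apply/andP; split.
  have := derive_ndecr (fun u (_ : 0 <= u <= T) => d1 u) _ (lexx 0) t0 tT.
  rewrite P0 addr0 => h; suff : e + g 0%N x <= P t + g 0%N (x + t) by rewrite /P; lra.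
  by apply: h => u /IH; rewrite ler_norml; lra.
have := derive_ndecr (fun u (_ : 0 <= u <= T) => d2 u) _ (lexx 0) t0 tT.
rewrite P0 addr0 => h; suff : e - g 0%N x <= P t - g 0%N (x + t) by rewrite /P; lra.
by apply: h => u /IH; rewrite ler_norml; lra.
Qed.

(** Were all derivatives of order below n smaller than e at x, Taylor's formula would give |g y| <=
    d/4 + d/4. First n makes the remainder small, then e the rest; neither depends on g. *)
Lemma exists_large_derivative (M D l d : R) : 0 <= M -> 0 <= D -> 0 < l -> 0 < d ->
  exists n e, 0 < e /\ forall (g : nat -> R -> R), derivative_chain g ->
    (forall k x, `|g k x| <= M * D ^+ k) ->
    forall x y, x <= y <= x + l -> d <= `|g 0%N y| ->
    exists2 k, (k < n)%N & e <= `|g k x|.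
Proof.
move=> M0 D0 l0 d0.
have [n nP] : exists n, M * ((D * l) ^+ n / n`!%:R) <= d / 4.
  have d4 : 0 < d / (4 * (M + 1)) by rewrite divr_gt0// mulr_gt0//; lra.
  have /cvgrPdist_le/(_ _ d4) := cvg_series_cvg_0 (@is_cvg_series_exp_coeff R (D * l)).
  case=> n _ /(_ n (leqnn n)) /=; rewrite sub0r normrN /exp_coeff => h.
  exists n; move: h; rewrite ger0_norm; last first.
    by rewrite divr_ge0// exprn_ge0// mulr_ge0// ltW.
  move=> /(ler_wpM2l M0) /le_trans; apply.
  by rewrite mulrA ler_pdivrMr ?mulr_gt0//; nra.
exists n, (d / (4 * expR l)).
have el : 0 < expR l := expR_gt0 l.
have e0 : 0 < d / (4 * expR l) by rewrite divr_gt0// mulr_gt0.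
split=> // g gP gB x y xy dy.
apply: contrapT => h.
have gk k : (k < n)%N -> `|g k x| <= d / (4 * expR l).
  by move=> kn; rewrite leNgt; apply/negP => /ltW ?; apply: h; exists k.
have yl : 0 <= y - x <= l by lra.
have := taylor_majorant gP (ltW e0) gk (fun t (_ : 0 <= t <= l) => gB n (x + t)) yl.
rewrite addrC subrK.
have h1 : d / (4 * expR l) * expR (y - x) <= d / 4.
  have : expR (y - x) <= expR l by rewrite ler_expR; lra.
  move=> /(ler_wpM2l (ltW e0)) /le_trans; apply.
  by rewrite invfM mulrA mulfVK ?gt_eqF.
have h2 : M * D ^+ n * ((y - x) ^+ n / n`!%:R) <= d / 4.
  apply: le_trans nP; rewrite -mulrA ler_wpM2l// mulrA ler_wpM2r ?invr_ge0//.
  by rewrite exprMn ler_wpM2l ?exprn_ge0// lerXn2r ?nnegrE//; lra.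
by lra.
Qed.

(** * Uniform sublevel estimates and part (i) *)

Lemma trigsum_chain_bounded s A B (W M : R) : 0 < W -> (forall w, w \in s -> `|w| <= W) ->
  (forall x, `|trigsum s A B x| <= M) ->
  forall k x, `|trigsum_chain s A B k x| <= M * (4 * W) ^+ k.
Proof.
move=> W0 sW gM; elim=> [|k IH] x; first by rewrite mulr1; exact: gM.
have := trigsum_bernstein W0 sW IH x.
by rewrite exprS mulrCA.
Qed.

(** As k < n and D >= 1, the derivative of order k + 1 is at most M D^n, so the one of order k stays
    of size at least e/2 on a window whose length does not depend on k. *)
Lemma chain_sublevel (g : nat -> R -> R) n k (M D e x t : R) : derivative_chain g ->
  0 <= M -> 1 <= D -> 0 < e -> (forall k x, `|g k x| <= M * D ^+ k) ->
  (k < n)%N -> e <= `|g k x| -> 0 < t <= 1 ->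
  outer_le ([set y | `|g 0%N y| < e / 2 * t ^+ n] `&`
    [set y | x <= y <= x + e / (2 * (M + 1) * D ^+ n)]) (16 * 2 ^+ n * t).
Proof.
move=> gP M0 D1 e0 gB kn; set h := e / (2 * _ * _) => ek /andP[t0 t1].
have D0 : 0 < D by lra.
have Dn : 0 < D ^+ n by rewrite exprn_gt0.
have h0 : 0 < h by rewrite divr_gt0// !mulr_gt0//; lra.
have e2 : 0 < e / 2 by rewrite divr_gt0.
wlog gpos : g gP gB ek / e <= g k x => [wl|].
  have [gk0|gk0] := leP 0 (g k x).
    by apply: wl => //; rewrite -(ger0_norm gk0).
  have := wl (fun k x => - g k x); rewrite normrN -(ltr0_norm gk0).
  move=> W; apply: (outer_le_sub (W _ _ ek ek)).
  - move=> j y; have ? := gP j y; exact: is_deriveN.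
  - by move=> j y; rewrite normrN.
  - by move=> y [/= ? ?]; split=> //=; rewrite normrN.
have gk2 y : x <= y <= x + h -> e / 2 <= g k y.
  move=> /andP[xy yh].
  have gE z : x <= z <= y -> 0 <= M * D ^+ n + g k.+1 z.
    move=> _; have := gB k.+1 z; rewrite ler_norml => /andP[+ _].
    have : M * D ^+ k.+1 <= M * D ^+ n by rewrite ler_wpM2l// ler_weXn2l.
    by lra.
  have dG z : x <= z <= y -> is_derive z 1 (fun z => M * D ^+ n * z + g k z) (M * D ^+ n + g k.+1 z).
    by move=> _; have ? := gP k z; apply: is_derive_eq; rewrite /GRing.scale/= mulr1.
  have := derive_ndecr dG gE (lexx x) xy (lexx y).
  have : M * D ^+ n * (y - x) <= e / 2.
    have : M * D ^+ n * (y - x) <= (M + 1) * D ^+ n * h.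
      by apply: ler_pM; rewrite ?mulr_ge0 ?(ltW Dn)//; [lra|rewrite ler_wpM2r ?(ltW Dn)//; lra|lra].
    move=> /le_trans; apply; rewrite /h le_eqVlt; apply/orP; left; apply/eqP; field.
    by rewrite !gt_eqF//; lra.
  by lra.
have xh : x <= x + h by lra.
have F := sublevel_derivative gP xh e2 t0 gk2.
(* Since t <= 1, replacing k by n shrinks the set and enlarges the bound. *)
apply: (outer_le_sub (outer_leW _ F)).
  by rewrite ler_wpM2r ?(ltW t0)// ler_wpM2l// ler_weXn2l// ?ler1n// ltnW.
move=> y [/= gy xy]; split=> //; apply: lt_le_trans gy _.
by rewrite ler_wpM2l ?(ltW e2)// ler_wiXn2l ?(ltW t0)// ltnW.
Qed.

(** An empty spectrum has supremum -oo, so a finite bandwidth also provides a frequency. *)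
Lemma spectrum_bounded f : bandwidth f \is a fin_num ->
  (exists w, spectrum f w) /\ exists2 W, 1 <= W & forall w, spectrum f w -> `|w| <= W.
Proof.
rewrite /bandwidth fin_numB => /andP[supf inff].
split.
  apply: contrapT => /forallNP h.
  have e : spectrum f = set0 by rewrite -subset0 => w /h.
  by move: supf; rewrite e image_set0 ereal_sup0.
pose b := fine (ereal_sup (EFin @` spectrum f)).
pose a := fine (ereal_inf (EFin @` spectrum f)).
exists (`|a| + `|b| + 1); first by have := normr_ge0 a; have := normr_ge0 b; lra.
move=> w fw.
have wb : w <= b by rewrite -lee_fin fineK//; apply: ereal_sup_ubound; exists w.
have aw : a <= w by rewrite -lee_fin fineK//; apply: ereal_inf_lbound; exists w.
have := ler_norm b; have := ler_norm (- a); rewrite normrN => ? ?.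
have := normr_ge0 a; have := normr_ge0 b => ? ?.
by rewrite ler_norml; lra.
Qed.

Theorem almost_periodic_sublevel f : uniformly_almost_periodic f ->
  bandwidth f \is a fin_num ->
  exists (C : R) (n : nat), [/\ 0 < C, (1 <= n)%N &
    forall u : R, 0 < u -> J f u <= C * u `^ n%:R^-1].
Proof.
move=> fU /spectrum_bounded[[w fw] [W W1 fW]].
have [l [d [l0 d0 fd]]] := almost_periodic_window fU fw.
have [_ [M0 fM0] _] := fU.
pose M := M0 + 1.
have M00 : 0 <= M0 := le_trans (cabs_ge0 _) (fM0 0).
have W0 : 0 < W by lra.
have D1 : 1 <= 4 * W by lra.
have M0' : 0 <= M by rewrite /M; lra.
have D0 : 0 <= 4 * W by lra.
have d4 : 0 < d / 4 by rewrite divr_gt0.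
(* At a point where |p| >= d/2, the real or the imaginary part is at least d/4. *)
have [n' [e [e0 nP]]] := exists_large_derivative M0' D0 l0 d4.
pose n := n'.+1.
pose h := e / (2 * (M + 1) * (4 * W) ^+ n).
have h0 : 0 < h by rewrite divr_gt0// !mulr_gt0 ?exprn_gt0//; rewrite /M; lra.
(* From 3L/h windows with 16 2^n t each, divided by 2L. *)
pose C' := 24 * 2 ^+ n / h.
have C'0 : 0 < C' by rewrite divr_gt0// mulr_gt0// exprn_gt0.
(* With u = H t^n, the inequality |p| < 2u is the one treated by [chain_sublevel]. *)
pose H := e / 4.
have H0 : 0 < H by rewrite divr_gt0.
(* The added 1 covers t > 1, where the density is at most 1 < t. *)
exists ((C' + 1) * H `^ (- n%:R^-1)), n; split=> //.
  by rewrite mulr_gt0 ?powR_gt0//; lra.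
move=> u u0; have [t t0 [ut tE]] := power_sublevel (ltn0Sn n') H0 u0.
rewrite -mulrA -tE.
have [t1|t1] := leP t 1; last first.
  by apply: le_trans (mean_measure_le1 _) _; nra.
apply: (@le_trans _ _ (C' * t)); last by nra.
apply: mean_measure_le; first by rewrite mulr_ge0// ltW.
exists h => L hL.
(* The approximant depends on u. Error u gives |p| < 2u on the set, error 1 gives |p| <= M, and
   error d/2 keeps |p| >= d/2 at the large values of f. *)
pose eta := Num.min u (Num.min 1 (d / 2)).
have eta0 : 0 < eta by rewrite !lt_min u0 ltr01 divr_gt0.
have [s [a [sf fp]]] := bochner_fejer fU eta0.
have fpu x : cabs (f x - expsum s a x) <= u.
  by apply: le_trans (fp x) _; rewrite ge_min lexx.
have fp1 x : cabs (f x - expsum s a x) <= 1.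
  by apply: le_trans (fp x) _; rewrite !ge_min lexx !orbT.
have fpd x : cabs (f x - expsum s a x) <= d / 2.
  by apply: le_trans (fp x) _; rewrite !ge_min lexx !orbT.
have tri x : cabs (expsum s a x) <= cabs (f x) + cabs (f x - expsum s a x).
  by have := cabsD (f x) (- (f x - expsum s a x)); rewrite cabsN subKr.
have tri' x : cabs (f x) <= cabs (expsum s a x) + cabs (f x - expsum s a x).
  by have := cabsD (expsum s a x) (f x - expsum s a x); rewrite subrKC.
have pM x : cabs (expsum s a x) <= M by have := tri x; have := fM0 x; have := fp1 x; rewrite /M; lra.
have sW v : v \in s -> `|v| <= W by move=> /sf/fW.
pose AR v := complex.Re (a v); pose AI v := complex.Im (a v).
pose gR := trigsum_chain s AR (fun v => - AI v).
pose gI := trigsum_chain s AI AR.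
have RE x : complex.Re (expsum s a x) = gR 0%N x by rewrite Re_expsum.
have IE x : complex.Im (expsum s a x) = gI 0%N x by rewrite Im_expsum.
have gRB : forall k x, `|gR k x| <= M * (4 * W) ^+ k.
  apply: trigsum_chain_bounded => // x; rewrite -[trigsum _ _ _ _]/(gR 0%N x) -RE.
  exact: le_trans (ler_Re_cabs _) (pM x).
have gIB : forall k x, `|gI k x| <= M * (4 * W) ^+ k.
  apply: trigsum_chain_bounded => // x; rewrite -[trigsum _ _ _ _]/(gI 0%N x) -IE.
  exact: le_trans (ler_Im_cabs _) (pM x).
have gRP : derivative_chain gR by exact: trigsum_chainP.
have gIP : derivative_chain gI by exact: trigsum_chainP.
have t01 : 0 < t <= 1 by rewrite t0.
have loc x : outer_le ([set y | cabs (f y) < u] `&` [set y | x <= y <= x + h]) (16 * 2 ^+ n * t).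
  have pu y : cabs (f y) < u -> cabs (expsum s a y) < e / 2 * t ^+ n.
    move=> fy; have -> : e / 2 * t ^+ n = u + u by rewrite {1 2}ut /H; lra.
    by have := tri y; have := fpu y; lra.
  have [y [xy dy]] := fd x.
  have : d / 2 <= cabs (expsum s a y) by have := tri' y; have := fpd y; lra.
  move=> /le_trans/(_ (ler_cabs_ReIm _)) dRI.
  have [dR|dR] := leP (d / 4) `|complex.Re (expsum s a y)|.
    rewrite RE in dR; have [k kn ek] := nP gR gRP gRB x y xy dR.
    apply: (outer_le_sub (chain_sublevel gRP M0' D1 e0 gRB (ltnW kn : (k < n)%N) ek t01)).
    move=> v [/= /pu fv xv]; split=> //=.
    by apply: le_lt_trans fv; rewrite -RE ler_Re_cabs.
  have dI : d / 4 <= `|gI 0%N y| by rewrite -IE; lra.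
  have [k kn ek] := nP gI gIP gIB x y xy dI.
  apply: (outer_le_sub (chain_sublevel gIP M0' D1 e0 gIB (ltnW kn : (k < n)%N) ek t01)).
  move=> v [/= /pu fv xv]; split=> //=.
  by apply: le_lt_trans fv; rewrite -IE ler_Im_cabs.
have hL' : 0 < h <= L by rewrite h0.
have := outer_le_long hL' loc; apply: outer_leW.
by rewrite le_eqVlt; apply/orP; left; apply/eqP; rewrite /C'; field; exact: lt0r_neq0.
Qed.

End lower_bound.

Theorem theorem1 (R : realType) :
  (forall f : R -> R[i],
     uniformly_almost_periodic f -> f <> cst 0 ->
     bandwidth f \is a fin_num ->
     exists (C : R) (n : nat), [/\ 0 < C, (1 <= n)%N &
       forall u : R, 0 < u -> J f u <= C * u `^ n%:R^-1]) /\
  (exists C : nat -> R, forall n : nat, (1 <= n)%N ->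
     forall a : trigpoly R, #|` finsupp a| = n.+1 ->
     forall u : R, 0 < u ->
       J (trigpoly_fun a) u <=
         C n * height a `^ (- n%:R^-1) * u `^ n%:R^-1).
Proof.
split; last exact: trigpoly_sublevel.
by move=> f fU _; exact: almost_periodic_sublevel.
Qed.
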